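(* Let $\chi:\mathbb{Z}\to\mathbb{C}$ be a periodic function of period $m\ge1$ with $\chi(0)=0$, and let $n\ge0$ be an integer. The twisted Stirling-Ramanujan constants $\hat S_{n,0}(\chi),\ldots,\hat S_{n,m-1}(\chi)$ are exponential periods over the field $\mathbb{Q}(\chi)(t,e^{-t})$.
   Context: For $\ell=0,1,\ldots,m-1$, $\hat S_{n,\ell}(\chi)$ is the constant term (coefficient of $s^0$) in the asymptotic expansion, as the integer $s\to+\infty$, of $$\sum_{k=1}^{ms+\ell}\chi(k)\,k^n\log k$$ in the family of functions $s^j\log s$ ($j\ge0$) and $s^j$ ($j\in\mathbb{Z}$); this expansion exists and is unique. $\mathbb{Q}(\chi)$ is the field generated over $\mathbb{Q}$ by the values of $\chi$, and $\mathbb{Q}(\chi)(t,e^{-t})$ is the field of meromorphic functions of $t$ generated over it by $t$ and $e^{-t}$. A complex number is an exponential period over a field $\mathbb{F}$ of meromorphic functions of $t$ if it equals a convergent integral $\int_0^{+\infty}f(t)\,dt$ with $f\in\mathbb{F}$. *)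

(* Defs.v *)
From Stdlib Require Import Reals ZArith.
From Coquelicot Require Import Coquelicot.

(** * Constant terms of asymptotic expansions *)

(* [u s = sum_(0 <= j <= J) a_j s^j log s + sum_(-N <= j <= J) b_j s^j + o(s^(-N))]
   for every [N].  The sum over [-N <= j <= J] is indexed by [i = j + N]. *)
Definition has_expansion (u : nat -> C) (J : nat) (a : nat -> C) (b : Z -> C) : Prop :=
  forall N : nat,
    is_lim_seq
      (fun s : nat =>
         (Cmod
            (u s
             - sum_n (fun j => a j * RtoC (INR s ^ j * ln (INR s)))%C J
             - sum_n (fun i => b (Z.of_nat i - Z.of_nat N)%Z
                               * RtoC (powerRZ (INR s) (Z.of_nat i - Z.of_nat N)))%C
                     (J + N))%C
          * INR s ^ N)%R)
      0%R.

Definition is_constant_term (u : nat -> C) (c : C) : Prop :=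
  exists (J : nat) (a : nat -> C) (b : Z -> C), has_expansion u J a b /\ b 0%Z = c.

(* [iota] is Coquelicot's definite description operator. *)
Definition constant_term (u : nat -> C) : C :=
  iota (T := C_R_CompleteNormedModule) (is_constant_term u).

Definition twisted_log_sum (chi : Z -> C) (n N : nat) : C :=
  sum_n_m (fun k => chi (Z.of_nat k) * RtoC (INR k ^ n * ln (INR k)))%C 1 N.

Definition twisted_stirling (chi : Z -> C) (m n l : nat) : C :=
  constant_term (fun s => twisted_log_sum chi n (m * s + l)).

(** * Fields of numbers and of functions *)

Definition is_subfield (K : C -> Prop) : Prop :=
  K (RtoC 1) /\
  (forall x y, K x -> K y -> K (x - y)%C) /\
  (forall x y, K x -> K y -> K (x * y)%C) /\
  (forall x, K x -> x <> RtoC 0 -> K (/ x)%C).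

(* The smallest subfield of [C] containing the values of [chi]; as every
   subfield of [C] contains the rationals, this is Q(chi). *)
Definition value_field (chi : Z -> C) (z : C) : Prop :=
  forall K : C -> Prop, is_subfield K -> (forall k, K (chi k)) -> K z.

Definition Cexp (z : C) : C :=
  ((exp (Re z) * cos (Im z))%R, (exp (Re z) * sin (Im z))%R).

Definition poly2 (d : nat) (p : nat -> nat -> C) (x y : C) : C :=
  sum_n (fun i => sum_n (fun j => p i j * x ^ i * y ^ j)%C d) d.

(* The field K(t, exp(-t)): quotients of polynomials in t and exp(-t) over K
   whose denominator is not the zero function.  A meromorphic function is
   represented by a total function on [C], whose values at the (isolated)
   zeros of the denominator are left unspecified; only finitely many of these
   zeros are real, so these values do not affect integrals along [R]. *)
Definition rat_t_exp (K : C -> Prop) (f : C -> C) : Prop :=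
  exists (d : nat) (p q : nat -> nat -> C),
    (forall i j, K (p i j)) /\
    (forall i j, K (q i j)) /\
    (exists t, poly2 d q t (Cexp (- t)%C) <> RtoC 0) /\
    (forall t, poly2 d q t (Cexp (- t)%C) <> RtoC 0 ->
       f t = (poly2 d p t (Cexp (- t)) / poly2 d q t (Cexp (- t)))%C).

(* [F] is a field of meromorphic functions; the integral over ]0, +oo[ is
   improper at both ends. *)
Definition exponential_period (F : (C -> C) -> Prop) (z : C) : Prop :=
  exists f : C -> C, F f /\
    is_RInt_gen (V := C_R_NormedModule) (fun t : R => f (RtoC t))
      (at_right 0) (Rbar_locally p_infty) z.

(* Main.v *)
(* Frullani's integral and its regularisations write [y ^ n * ln y], up to a
   multiple of [y ^ n], as the integral over ]0, +oo[ of [log_kernel n y t],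
   which is [exp (- (y * t)) / t ^ (n + 1)] minus counterterms.  Summing over an
   arithmetic progression [p + m j] up to [m s] turns the exponentials into
     [G p t - exp (- (m s t)) * G p' t],  [G p t = exp (- (p t)) / (1 - exp (- (m t)))].
   The first term, regularised by its own Taylor coefficients at [0], does not
   depend on [s] and contributes a constant integral of an element of
   Q(t, exp(-t)).  The principal part of [G p'] at [0] gives back logarithmic
   kernels at [y = m s], whence powers of [s] and powers times [ln s], and its
   remainder gives negative powers of [s] by Watson's lemma.  The counterterms
   cancel because both sides are bounded near [0].  The constant term is thus
   an integral of an element of Q(t, exp(-t)) for each residue class modulo [m],
   and the classes are recombined with the coefficients [chi]. *)
Require Import Defs.
From Stdlib Require Import Reals ZArith Lra Lia Psatz IndefiniteDescription.
From Coquelicot Require Import Coquelicot.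
Local Open Scope R_scope.

(** * Integrals over the half line *)

(** Two constants arise that are not visibly of the required form. Integrating [log_kernel n y]
    yields, besides [y ^ n * ln y], a multiple [exp_const n] of [y ^ n], so the logarithmic sum
    comes with a power sum, whose constant term is needed too. No separate Faulhaber formula is
    proved: the comparison near 0 that cancels the counterterms also forces the coefficient of
    [exp (- t) / t] to vanish, and this is the closed form of the power sum. Its constant term is
    rational, so [exp_const n], never evaluated, enters as a rational multiple of its own defining
    integral. The other constant is [ln m], from [ln (m * s)]; it stays a Frullani integral. The
    last counterterm carries [exp (- t)] because [1 / t] is not integrable at infinity, whereas the
    earlier ones decay at least like [1 / t ^ 2]. Taylor expansions are taken of [t * G], without
    pole at 0, which shifts the orders by one and explains the indices [n + 1] and [n + 2]. *)

Definition is_half_line_RInt {V : NormedModule R_AbsRing} (f : R -> V) (l : V) : Prop :=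
  is_RInt_gen f (at_right 0) (Rbar_locally p_infty) l.

Lemma at_right_0_pos : at_right 0 (fun x => 0 < x).
Proof. exists (mkposreal 1 Rlt_0_1); intros y _ Hy; exact Hy. Qed.

Lemma p_infty_gt (M : R) : Rbar_locally p_infty (fun x => M < x).
Proof. now exists M. Qed.

Lemma at_right_0_lt (d : posreal) : at_right 0 (fun x => 0 < x < d).
Proof.
  exists d; intros y Hy Hy0; split; [exact Hy0|].
  change (Rabs (y - 0) < d) in Hy.
  rewrite Rminus_0_r, Rabs_pos_eq in Hy; lra.
Qed.

Lemma half_line_RInt_ext {V : NormedModule R_AbsRing} (f g : R -> V) (l : V) :
  (forall t, 0 < t -> f t = g t) -> is_half_line_RInt f l -> is_half_line_RInt g l.
Proof.
  intros H; apply is_RInt_gen_ext.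
  apply Filter_prod with (1 := at_right_0_pos) (2 := p_infty_gt 0).
  intros a b Ha Hb x [Hx _]; simpl in Hx; apply H.
  apply Rlt_trans with (2 := Hx); apply Rmin_glb_lt; assumption.
Qed.

(** Both ends are improper and [F] absorbs both: it has to be an antiderivative on the open half
    line with a limit at each end, and nothing is asked at 0 itself. *)
Lemma half_line_RInt_antiderivative {V : NormedModule R_AbsRing} (f F : R -> V) (A B : V) :
  (forall a b, 0 < a -> 0 < b -> is_RInt f a b (minus (F b) (F a))) ->
  filterlim F (at_right 0) (locally A) ->
  filterlim F (Rbar_locally p_infty) (locally B) ->
  is_half_line_RInt f (minus B A).
Proof.
  intros HF HA HB.
  assert (HL : filterlim (fun ab : R * R => minus (F (snd ab)) (F (fst ab)))
     (filter_prod (at_right 0) (Rbar_locally p_infty)) (locally (minus B A))).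
  { unfold minus; eapply filterlim_comp_2.
    - eapply filterlim_comp; [apply filterlim_snd | exact HB].
    - eapply filterlim_comp; [eapply filterlim_comp; [apply filterlim_fst | exact HA]|].
      apply filterlim_opp.
    - apply @filterlim_plus. }
  intros P HP; unfold filtermapi.
  assert (Hp : filter_prod (at_right 0) (Rbar_locally p_infty)
      (fun ab : R * R => 0 < fst ab /\ 0 < snd ab)).
  { apply Filter_prod with (1 := at_right_0_pos) (2 := p_infty_gt 0); simpl; auto. }
  assert (HPL : filter_prod (at_right 0) (Rbar_locally p_infty)
      (fun ab : R * R => P (minus (F (snd ab)) (F (fst ab))))) by exact (HL P HP).
  generalize (filter_and _ _ HPL Hp).
  apply filter_imp; intros [a b] [H1 [H2 H3]]; simpl in *.
  eexists; split; [apply HF; assumption | exact H1].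
Qed.

Lemma ex_RInt_pos {V : CompleteNormedModule R_AbsRing} (f : R -> V) (a b : R) :
  (forall t, 0 < t -> continuous f t) -> 0 < a -> 0 < b -> ex_RInt f a b.
Proof.
  intros H Ha Hb; apply ex_RInt_continuous; intros z [Hz _]; apply H.
  apply Rlt_le_trans with (2 := Hz); apply Rmin_glb_lt; assumption.
Qed.

(** Increments of [f] are dominated by those of a convergent function, so [f] is Cauchy along [F].
    It is applied with [g = atan] at each of the two ends. *)
Lemma cauchy_transfer {F : (R -> Prop) -> Prop} {FF : ProperFilter F} (f g : R -> R) (M l : R)
  (D : R -> Prop) :
  F D -> 0 <= M ->
  (forall x y, D x -> D y -> Rabs (f x - f y) <= M * Rabs (g x - g y)) ->
  filterlim g F (locally l) -> exists l', filterlim f F (locally l').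
Proof.
  intros HD HM Hfg Hg.
  apply (proj1 (filterlim_locally_cauchy (U := R_CompleteSpace) f)).
  intros eps.
  (* [M + 1] keeps the denominator positive when [M = 0]; the factor 2 pays for the passage through
     [l]. *)
  assert (He : 0 < eps / (2 * (M + 1))).
  { apply Rdiv_lt_0_compat; [apply cond_pos | lra]. }
  exists (fun x => D x /\ ball l (mkposreal _ He) (g x)); split.
  { apply filter_and; [exact HD|].
    exact (proj1 (filterlim_locally (U := R_UniformSpace) g l) Hg (mkposreal _ He)). }
  intros u v [Du Bu] [Dv Bv].
  change (Rabs (f v - f u) < eps).
  change (Rabs (g u - l) < eps / (2 * (M + 1))) in Bu.
  change (Rabs (g v - l) < eps / (2 * (M + 1))) in Bv.
  apply Rle_lt_trans with (1 := Hfg v u Dv Du).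
  assert (Rabs (g v - g u) < 2 * (eps / (2 * (M + 1)))).
  { replace (g v - g u) with ((g v - l) - (g u - l)) by ring.
    apply Rle_lt_trans with (1 := Rabs_triang _ _).
    rewrite Rabs_Ropp; lra. }
  replace (2 * (eps / (2 * (M + 1)))) with (eps / (M + 1)) in H by (field; lra).
  apply Rle_lt_trans with (M * (eps / (M + 1))).
  { apply Rmult_le_compat_l; lra. }
  apply Rmult_lt_reg_r with (M + 1); [lra|].
  replace (M * (eps / (M + 1)) * (M + 1)) with (M * eps) by (field; lra).
  generalize (cond_pos eps); nra.
Qed.

Lemma atan_lim_0 : filterlim atan (at_right 0) (locally (atan 0)).
Proof.
  eapply filterlim_filter_le_1; [apply filter_le_within|].
  apply (ex_derive_continuous (V := R_NormedModule)).
  eexists; apply is_derive_Reals, derivable_pt_lim_atan.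
Qed.

Lemma atan_lim_p : filterlim atan (Rbar_locally p_infty) (locally (PI / 2)).
Proof.
  apply filterlim_locally; intros eps.
  destruct (Rle_dec (PI / 2) eps) as [H|H].
  - exists 0; intros x Hx.
    change (Rabs (atan x - PI / 2) < eps).
    assert (0 < atan x) by (rewrite <- atan_0; apply atan_increasing; exact Hx).
    generalize (atan_bound x); intros [_ Hu].
    rewrite Rabs_left; lra.
  - exists (tan (PI / 2 - eps)); intros x Hx.
    change (Rabs (atan x - PI / 2) < eps).
    apply atan_increasing in Hx.
    generalize (cond_pos eps) PI_RGT_0; intros.
    rewrite atan_tan in Hx by lra.
    generalize (atan_bound x); intros [_ Hu].
    rewrite Rabs_left; lra.
Qed.

Lemma atan_RInt (M a b : R) :
  is_RInt (fun t => M * / (1 + t²)) a b (M * (atan b - atan a)).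
Proof.
  replace (M * (atan b - atan a)) with (scal M (minus (atan b) (atan a))) by reflexivity.
  apply (is_RInt_scal (V := R_NormedModule) (fun t => / (1 + t²))).
  apply (is_RInt_derive (V := R_CompleteNormedModule)).
  - intros x _; apply is_derive_Reals.
    rewrite Rsqr_pow2; apply derivable_pt_lim_atan.
  - intros x _. apply (ex_derive_continuous (V := R_NormedModule)).
    assert (0 < 1 + x²) by (generalize (Rle_0_sqr x); lra).
    unfold Rsqr; auto_derive. unfold Rsqr in H; lra.
Qed.

(** The majorant has the antiderivative [M * atan], with finite limits at 0 and at infinity, so one
    bound controls both improper ends. *)
Lemma ex_half_line_RInt_dominated (f : R -> R) (M : R) :
  (forall t, 0 < t -> continuous f t) ->
  (forall t, 0 < t -> Rabs (f t) <= M * / (1 + t²)) ->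
  exists l, is_half_line_RInt f l.
Proof.
  intros Hc Hb.
  assert (HM : 0 <= M).
  { generalize (Hb 1 Rlt_0_1) (Rabs_pos (f 1)); unfold Rsqr; intros; lra. }
  assert (Hle : forall x y, 0 < x -> x <= y ->
      Rabs (RInt f x y) <= M * Rabs (atan y - atan x)).
  { intros x y Hx Hy.
    rewrite (Rabs_pos_eq (atan y - atan x)).
    2:{ destruct Hy as [Hy|Hy]; [apply atan_increasing in Hy; lra | subst; lra]. }
    apply (norm_RInt_le (V := R_NormedModule) f (fun t => M * / (1 + t²)) x y); auto.
    - intros t Ht; apply Hb; lra.
    - apply (RInt_correct (V := R_CompleteNormedModule)), ex_RInt_pos; auto; lra.
    - apply atan_RInt. }
  set (F := fun x => RInt f 1 x).
  assert (HF : forall a b, 0 < a -> 0 < b -> is_RInt f a b (minus (F b) (F a))).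
  { intros a b Ha Hb'.
    replace (minus (F b) (F a)) with (RInt f a b).
    - apply (RInt_correct (V := R_CompleteNormedModule)), ex_RInt_pos; auto.
    - unfold F. rewrite <- (RInt_Chasles f 1 a b) by (apply ex_RInt_pos; auto; lra).
      exact (eq_sym (Rplus_minus_l _ _)). }
  assert (HD : forall x y, 0 < x -> 0 < y -> Rabs (F x - F y) <= M * Rabs (atan x - atan y)).
  { intros x y Hx Hy.
    assert (E : forall x y, 0 < x -> 0 < y -> F y - F x = RInt f x y).
    { intros; symmetry; apply (is_RInt_unique (V := R_CompleteNormedModule)), HF; auto. }
    destruct (Rle_dec x y) as [H|H].
    - rewrite Rabs_minus_sym, (Rabs_minus_sym (atan x)), E by auto; auto.
    - rewrite E by auto; apply Hle; lra. }
  destruct (cauchy_transfer F atan M (atan 0) (fun x => 0 < x) at_right_0_pos HM HD atan_lim_0)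
    as [A HA].
  destruct (cauchy_transfer F atan M (PI/2) (fun x => 0 < x) (p_infty_gt 0) HM HD atan_lim_p)
    as [B HB].
  exists (minus B A); apply half_line_RInt_antiderivative with F; auto.
Qed.

Lemma ex_half_line_RInt_decay (f : R -> R) (M : R) :
  (forall t, 0 < t -> continuous f t) ->
  (forall t, 0 < t <= 1 -> Rabs (f t) <= M) ->
  (forall t, 1 <= t -> Rabs (f t) <= M / t ^ 2) ->
  exists l, is_half_line_RInt f l.
Proof.
  intros Hc H0 H1.
  assert (HM : 0 <= M).
  { apply Rle_trans with (1 := Rabs_pos (f 1)), H0; lra. }
  (* The factor 2 bounds [1 + t ^ 2] up to 1 and [(1 + t ^ 2) / t ^ 2] beyond 1. *)
  apply ex_half_line_RInt_dominated with (2 * M); auto.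
  intros t Ht.
  assert (Hp : 0 < 1 + t²) by (generalize (Rle_0_sqr t); lra).
  apply Rmult_le_reg_r with (1 + t²); auto.
  rewrite Rmult_assoc, Rinv_l, Rmult_1_r by lra.
  destruct (Rle_dec t 1) as [H|H].
  - apply Rle_trans with (M * 2); [|lra].
    apply Rmult_le_compat; auto using Rabs_pos; try lra.
    unfold Rsqr; nra.
  - apply Rle_trans with (M / t ^ 2 * (1 + t²)).
    + apply Rmult_le_compat_r; [lra | apply H1; lra].
    + apply Rmult_le_reg_r with (t ^ 2); [apply pow_lt; auto|].
      replace (M / t ^ 2 * (1 + t²) * t ^ 2) with (M * (1 + t²)) by (field; lra).
      assert (1 <= t ^ 2) by (simpl; nra).
      rewrite Rsqr_pow2; nra.
Qed.

Lemma half_line_RInt_unique (f : R -> R) (a b : R) :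
  is_half_line_RInt f a -> is_half_line_RInt f b -> a = b.
Proof.
  intros Ha Hb.
  rewrite <- (is_RInt_gen_unique (V := R_CompleteNormedModule) f a Ha).
  exact (is_RInt_gen_unique (V := R_CompleteNormedModule) f b Hb).
Qed.

Lemma half_line_RInt_plus (f g : R -> R) (a b : R) :
  is_half_line_RInt f a -> is_half_line_RInt g b ->
  is_half_line_RInt (fun t => f t + g t) (a + b).
Proof. exact (is_RInt_gen_plus (V := R_NormedModule) f g a b). Qed.

Lemma half_line_RInt_minus (f g : R -> R) (a b : R) :
  is_half_line_RInt f a -> is_half_line_RInt g b ->
  is_half_line_RInt (fun t => f t - g t) (a - b).
Proof. exact (is_RInt_gen_minus (V := R_NormedModule) f g a b). Qed.

Lemma half_line_RInt_scal (c : R) (f : R -> R) (a : R) :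
  is_half_line_RInt f a -> is_half_line_RInt (fun t => c * f t) (c * a).
Proof. exact (is_RInt_gen_scal (V := R_NormedModule) f c a). Qed.

Lemma half_line_RInt_const0 : is_half_line_RInt (fun _ => 0) 0.
Proof.
  assert (H : is_half_line_RInt (fun _ => 0) (minus 0 0)).
  2: now rewrite minus_eq_zero in H.
  apply (half_line_RInt_antiderivative (V := R_NormedModule) (fun _ => 0) (fun _ => 0)).
  - intros a b _ _; generalize (is_RInt_const (V := R_NormedModule) a b 0).
    change (scal (b - a) 0) with ((b - a) * 0); rewrite Rmult_0_r.
    now rewrite minus_eq_zero.
  - apply filterlim_const.
  - apply filterlim_const.
Qed.

Lemma half_line_RInt_norm_le (f g : R -> R) (a b : R) :
  (forall t, 0 < t -> Rabs (f t) <= g t) ->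
  is_half_line_RInt f a -> is_half_line_RInt g b -> Rabs a <= b.
Proof.
  intros H Ha Hb.
  apply (RInt_gen_norm (V := R_CompleteNormedModule) (Fa := at_right 0)
    (Fb := Rbar_locally p_infty) f g a b); auto.
  - apply Filter_prod with (1 := at_right_0_lt (mkposreal 1 Rlt_0_1)) (2 := p_infty_gt 1).
    simpl; intros; lra.
  - apply Filter_prod with (1 := at_right_0_pos) (2 := p_infty_gt 0).
    simpl; intros x y Hx Hy t Ht; apply H; lra.
Qed.

(** The substitution maps neighbourhoods of each end to neighbourhoods of the same end, with the
    bounds [d] and [M] divided by [y]. *)
Lemma half_line_RInt_scale (f : R -> R) (y l : R) :
  0 < y -> is_half_line_RInt f l -> is_half_line_RInt (fun t => y * f (y * t)) l.
Proof.
  intros Hy Hf P HP.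
  destruct (Hf P HP) as [Q1 Q2 [d HQ1] [M HQ2] HQ].
  assert (Hd : 0 < d / y) by (apply Rdiv_lt_0_compat; auto; apply cond_pos).
  apply Filter_prod with (fun x => 0 < x < d / y) (fun x => M / y < x).
  - exact (at_right_0_lt (mkposreal _ Hd)).
  - apply p_infty_gt.
  - intros a b Ha Hb; simpl.
    destruct (HQ (y * a) (y * b)) as [z [Hz1 Hz2]].
    + apply HQ1.
      * change (Rabs (y * a - 0) < d).
        rewrite Rminus_0_r, Rabs_pos_eq by nra.
        apply Rmult_lt_reg_r with (/ y); [apply Rinv_0_lt_compat; auto|].
        replace (y * a * / y) with a by (field; lra). exact (proj2 Ha).
      * nra.
    + apply HQ2. apply Rmult_lt_reg_r with (/ y); [apply Rinv_0_lt_compat; auto|].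
      replace (y * b * / y) with b by (field; lra). exact Hb.
    + exists z; split; auto; simpl in Hz1.
      apply is_RInt_ext with (fun t => scal y (f (y * t + 0))).
      * intros; rewrite Rplus_0_r; reflexivity.
      * apply (is_RInt_comp_lin (V := R_NormedModule)).
        rewrite !Rplus_0_r; exact Hz1.
Qed.

Lemma half_line_RInt_eq (f g : R -> R) (a b : R) :
  (forall t : R, 0 < t -> f t = g t) -> a = b ->
  is_half_line_RInt f a -> is_half_line_RInt g b.
Proof. intros H <-; now apply half_line_RInt_ext. Qed.

(** * Frullani's integral and the Gamma integral *)

(** Half of the exponential is spent at each step: [t * exp (- (y / 2 * t)) <= 2 / y] absorbs the
    new factor [t], and the induction hypothesis at [y / 2] the rest. *)
Lemma pow_mul_exp_bounded (j : nat) (y : R) :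
  0 < y -> exists C, 0 <= C /\ forall t, 0 < t -> t ^ j * exp (- (y * t)) <= C.
Proof.
  revert y; induction j as [|j IH]; intros y Hy.
  - exists 1; split; [lra|]; intros t Ht.
    rewrite <- exp_0; simpl; rewrite Rmult_1_l.
    left; apply exp_increasing; nra.
  - destruct (IH (y / 2) ltac:(lra)) as [C [HC H]].
    exists (C * (2 / y)); split.
    { apply Rmult_le_pos; [|apply Rlt_le, Rdiv_lt_0_compat]; lra. }
    intros t Ht.
    replace (t ^ S j * exp (- (y * t)))
      with ((t ^ j * exp (- (y / 2 * t))) * (t * exp (- (y / 2 * t)))).
    2:{ replace (- (y * t)) with (- (y / 2 * t) + - (y / 2 * t)) by field.
        rewrite exp_plus; simpl; ring. }
    apply Rmult_le_compat; auto.
    + apply Rmult_le_pos; [apply pow_le; lra | apply Rlt_le, exp_pos].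
    + apply Rmult_le_pos; [lra | apply Rlt_le, exp_pos].
    + assert (H1 : y / 2 * t <= exp (y / 2 * t)).
      { generalize (exp_ineq1_le (y / 2 * t)); lra. }
      rewrite exp_Ropp.
      apply Rmult_le_reg_r with (exp (y / 2 * t)); [apply exp_pos|].
      rewrite Rmult_assoc, Rinv_l, Rmult_1_r by (apply Rgt_not_eq, exp_pos).
      apply Rmult_le_reg_l with (y / 2); [lra|].
      replace (y / 2 * (2 / y * exp (y / 2 * t))) with (exp (y / 2 * t)) by (field; lra).
      exact H1.
Qed.

Lemma filterlim_p_infty_of_decay (f : R -> R) (C : R) :
  (forall t, 0 < t -> Rabs (f t) <= C / t) -> filterlim f (Rbar_locally p_infty) (locally 0).
Proof.
  intros H; apply filterlim_locally; intros eps.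
  generalize (cond_pos eps); intros He.
  exists (Rmax 0 (C / eps)); intros x Hx.
  assert (H0 : 0 < x) by (apply Rle_lt_trans with (2 := Hx), Rmax_l).
  assert (H1 : C / eps < x) by (apply Rle_lt_trans with (2 := Hx), Rmax_r).
  change (Rabs (f x - 0) < eps); rewrite Rminus_0_r.
  apply Rle_lt_trans with (1 := H x H0).
  apply Rmult_lt_reg_r with x; auto.
  replace (C / x * x) with C by (field; lra).
  apply Rmult_lt_reg_r with (/ eps); [now apply Rinv_0_lt_compat|].
  replace (eps * x * / eps) with x by (field; lra). exact H1.
Qed.

Lemma filterlim_at_right_0_of_linear (f : R -> R) (l C : R) :
  (forall t, 0 < t -> Rabs (f t - l) <= C * t) -> filterlim f (at_right 0) (locally l).
Proof.
  intros H; apply filterlim_locally; intros eps.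
  generalize (cond_pos eps); intros He.
  assert (HC : 0 <= C).
  { generalize (H 1 Rlt_0_1) (Rabs_pos (f 1 - l)); lra. }
  assert (Hd : 0 < eps / (C + 1)) by (apply Rdiv_lt_0_compat; lra).
  generalize (at_right_0_lt (mkposreal _ Hd)); apply filter_imp; simpl; intros x [H0 H1].
  change (Rabs (f x - l) < eps).
  apply Rle_lt_trans with (1 := H x H0).
  apply Rmult_lt_compat_r with (r := C + 1) in H1; [|lra].
  replace (eps / (C + 1) * (C + 1)) with (pos eps) in H1 by (field; lra). nra.
Qed.

Lemma continuous_at_right (f : R -> R) (l : R) :
  continuous f 0 -> f 0 = l -> filterlim f (at_right 0) (locally l).
Proof.
  intros H <-; eapply filterlim_filter_le_1; [apply filter_le_within | exact H].
Qed.

Lemma pow_mul_exp_lim (j : nat) (y : R) :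
  0 < y -> filterlim (fun t => t ^ j * exp (- (y * t))) (Rbar_locally p_infty) (locally 0).
Proof.
  intros Hy; destruct (pow_mul_exp_bounded (S j) y Hy) as [C [HC H]].
  apply filterlim_p_infty_of_decay with C; intros t Ht.
  rewrite Rabs_pos_eq.
  2:{ apply Rmult_le_pos; [apply pow_le; lra | apply Rlt_le, exp_pos]. }
  apply Rmult_le_reg_r with t; auto.
  replace (C / t * t) with C by (field; lra).
  generalize (H t Ht); simpl; lra.
Qed.

Lemma half_line_RInt_exp (y : R) :
  0 < y -> is_half_line_RInt (fun t => exp (- (y * t))) (/ y).
Proof.
  intros Hy.
  replace (/ y) with (minus (- / y * 0) (- / y) : R)
    by (unfold minus, plus, opp; simpl; ring).
  apply (half_line_RInt_antiderivative (V := R_NormedModule) _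
     (fun t => - / y * (t ^ 0 * exp (- (y * t))))).
  - intros a b _ _; apply (is_RInt_derive (V := R_CompleteNormedModule)
      (fun t => - / y * (t ^ 0 * exp (- (y * t))))).
    + intros x _; simpl; auto_derive; auto; field; lra.
    + intros x _; apply (ex_derive_continuous (V := R_NormedModule)); auto_derive; auto.
  - apply continuous_at_right.
    + apply (ex_derive_continuous (V := R_NormedModule)); simpl; auto_derive; auto.
    + rewrite Rmult_0_r, Ropp_0, exp_0; simpl; ring.
  - eapply filterlim_comp; [apply (pow_mul_exp_lim 0 y Hy)|].
    apply (filterlim_scal_r (V := R_NormedModule) (- / y)).
Qed.

(** Integration by parts: the derivative of [t ^ (k + 1) * exp (- (y * t))] integrates to 0, its
    primitive vanishing at both ends. *)
Lemma half_line_RInt_pow_exp (k : nat) (y : R) :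
  0 < y -> is_half_line_RInt (fun t => t ^ k * exp (- (y * t))) (INR (fact k) / y ^ S k).
Proof.
  intros Hy; induction k as [|k IH].
  - apply half_line_RInt_ext with (fun t => exp (- (y * t))).
    + intros; simpl; ring.
    + replace (INR (fact 0) / y ^ 1) with (/ y) by (simpl; field; lra).
      now apply half_line_RInt_exp.
  - assert (H : is_half_line_RInt
      (fun t => INR (S k) * (t ^ k * exp (- (y * t))) - y * (t ^ S k * exp (- (y * t))))
      (minus 0 0)).
    { apply (half_line_RInt_antiderivative (V := R_NormedModule) _
        (fun t => t ^ S k * exp (- (y * t)))).
      - intros a b _ _; apply (is_RInt_derive (V := R_CompleteNormedModule)
          (fun t => t ^ S k * exp (- (y * t)))).
        + intros x _; auto_derive; auto; simpl; ring.
        + intros x _; apply (ex_derive_continuous (V := R_NormedModule)); auto_derive; auto.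
      - apply continuous_at_right.
        + apply (ex_derive_continuous (V := R_NormedModule)); auto_derive; auto.
        + simpl; ring.
      - now apply pow_mul_exp_lim. }
    rewrite minus_eq_zero in H; change (@zero _) with 0 in H.
    generalize (half_line_RInt_scal (/ y) _ _ (half_line_RInt_minus _ _ _ _
       (half_line_RInt_scal (INR (S k)) _ _ IH) H)).
    apply half_line_RInt_eq.
    + intros t Ht; field; lra.
    + rewrite fact_simpl, mult_INR; simpl (y ^ _); field.
      split; [apply pow_nonzero|]; lra.
Qed.

(** For [z = y * x] the first bound sends the integral to 0 as [x] goes to infinity, while the
    second compares it with the integral of [1 / t] and gives [ln y] as [x] goes to 0. *)
Lemma exp_neg_div_RInt_bounds (x z : R) :
  0 < x <= z ->
  0 <= RInt (fun t => exp (- t) / t) x z <= exp (- x) / x * (z - x) /\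
  Rabs (ln z - ln x - RInt (fun t => exp (- t) / t) x z) <= z - x.
Proof.
  intros [Hx Hz].
  assert (HE : is_RInt (fun t => exp (- t) / t) x z (RInt (fun t => exp (- t) / t) x z)).
  { apply (RInt_correct (V := R_CompleteNormedModule)), ex_RInt_pos; [|lra|lra].
    intros t Ht; apply (ex_derive_continuous (V := R_NormedModule)); auto_derive; lra. }
  assert (Hl : is_RInt (fun t => / t) x z (ln z - ln x)).
  { apply (is_RInt_derive (V := R_CompleteNormedModule) ln).
    - intros t Ht; rewrite Rmin_left in Ht by auto; auto_derive; [lra | field; lra].
    - intros t Ht; rewrite Rmin_left in Ht by auto.
      apply (ex_derive_continuous (V := R_NormedModule)); auto_derive; lra. }
  assert (Hpos : forall t, x <= t -> 0 <= exp (- t) / t).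
  { intros; apply Rlt_le, Rdiv_lt_0_compat; [apply exp_pos | lra]. }
  assert (Hd := is_RInt_const (V := R_NormedModule) x z (exp (- x) / x)).
  assert (H0 := is_RInt_const (V := R_NormedModule) x z 0).
  assert (H1 := is_RInt_const (V := R_NormedModule) x z 1).
  split; [split|].
  - replace 0 with (scal (z - x) 0 : R) by apply Rmult_0_r.
    apply (is_RInt_le _ _ _ _ _ _ Hz H0 HE).
    intros t Ht; apply Hpos; lra.
  - rewrite Rmult_comm; apply (is_RInt_le _ _ _ _ _ _ Hz HE Hd).
    intros t Ht; unfold Rdiv; apply Rmult_le_compat.
    + apply Rlt_le, exp_pos.
    + apply Rlt_le, Rinv_0_lt_compat; lra.
    + left; apply exp_increasing; lra.
    + apply Rinv_le_contravar; lra.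
  - replace (z - x) with (scal (z - x) 1 : R) by apply Rmult_1_r.
    apply (norm_RInt_le (V := R_NormedModule) (fun t => / t - exp (- t) / t)
      (fun _ => 1) x z); auto.
    + intros t Ht; change (Rabs (/ t - exp (- t) / t) <= 1).
      assert (0 < / t) by (apply Rinv_0_lt_compat; lra).
      assert (exp (- t) < 1) by (rewrite <- exp_0; apply exp_increasing; lra).
      assert (H3 := exp_ineq1_le (- t)).
      replace (/ t - exp (- t) / t) with (/ t * (1 - exp (- t))) by (field; lra).
      rewrite Rabs_pos_eq by nra.
      apply Rmult_le_reg_l with t; [lra|].
      rewrite <- Rmult_assoc, Rinv_r; lra.
    + exact (is_RInt_minus (V := R_NormedModule) _ _ _ _ _ _ Hl HE).
Qed.

(** The integrand is [E t - y * E (y * t)] with [E t = exp (- t) / t]. Each part diverges at 0, but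
    together they have as antiderivative minus the integral of [E] over [[x, y * x]], which tends to
    [- ln y] at 0 and to 0 at infinity. *)
Lemma frullani_exp (y : R) :
  1 <= y -> is_half_line_RInt (fun t => (exp (- t) - exp (- (y * t))) / t) (ln y).
Proof.
  intros Hy.
  set (E := fun t => exp (- t) / t).
  assert (HE : forall a b, 0 < a -> 0 < b -> is_RInt E a b (RInt E a b)).
  { intros; apply (RInt_correct (V := R_CompleteNormedModule)), ex_RInt_pos; auto.
    intros t Ht; unfold E; apply (ex_derive_continuous (V := R_NormedModule)); auto_derive; lra. }
  assert (HC : forall a b c, 0 < a -> 0 < b -> 0 < c -> RInt E a c = RInt E a b + RInt E b c).
  { intros a b c Ha Hb Hc; symmetry.
    apply (RInt_Chasles (V := R_CompleteNormedModule)); eexists; apply HE; auto. }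
  assert (Heq : forall t : R, 0 < t ->
      E t - y * E (y * t) = (exp (- t) - exp (- (y * t))) / t).
  { intros t Ht; unfold E; field; lra. }
  assert (H : is_half_line_RInt (fun t => (exp (- t) - exp (- (y * t))) / t) (minus 0 (- ln y))).
  2:{ replace (minus 0 (- ln y) : R) with (ln y) in H; auto.
      unfold minus, plus, opp; simpl; ring. }
  apply (half_line_RInt_antiderivative (V := R_NormedModule) _ (fun x => - RInt E x (y * x))).
  - intros a b Ha Hb.
    assert (Ha' : 0 < y * a) by nra.
    assert (Hb' : 0 < y * b) by nra.
    assert (Hv : - RInt E b (y * b) - - RInt E a (y * a) = RInt E a b - RInt E (y * a) (y * b)).
    2: refine (eq_ind_r (fun v : R => is_RInt (V := R_NormedModule) _ a b v) _ Hv).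
    + rewrite (HC (y * a) a (y * b)), (HC a b (y * b)) by auto.
      assert (Hs : RInt E (y * a) a = - RInt E a (y * a)).
      { generalize (HC a (y * a) a Ha Ha' Ha).
        rewrite (RInt_point (V := R_CompleteNormedModule)).
        change (@zero _) with 0; intros; lra. }
      rewrite Hs; ring.
    + apply is_RInt_ext with (fun t => E t - scal y (E (y * t + 0))).
      * intros t Ht; assert (0 < t) by (apply Rle_lt_trans with (2 := proj1 Ht); apply Rmin_glb; lra).
        rewrite Rplus_0_r; exact (Heq t H).
      * apply (is_RInt_minus (V := R_NormedModule)); [now apply HE|].
        apply (is_RInt_comp_lin (V := R_NormedModule) E y 0).
        rewrite !Rplus_0_r; now apply HE.
  - apply filterlim_at_right_0_of_linear with (y - 1); intros t Ht.
    destruct (exp_neg_div_RInt_bounds t (y * t)) as [_ H]; [nra|].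
    fold E in H; rewrite ln_mult in H by lra.
    replace (- RInt E t (y * t) - - ln y) with (ln y + ln t - ln t - RInt E t (y * t)) by ring.
    lra.
  - destruct (pow_mul_exp_bounded 1 1 Rlt_0_1) as [C [HC0 HCt]].
    apply filterlim_p_infty_of_decay with ((y - 1) * C); intros t Ht.
    destruct (exp_neg_div_RInt_bounds t (y * t)) as [[H1 H2] _]; [nra|].
    fold E in H1, H2; rewrite Rabs_Ropp, Rabs_pos_eq by auto.
    apply Rle_trans with (1 := H2).
    replace (exp (- t) / t * (y * t - t)) with ((y - 1) * exp (- t)) by (field; lra).
    unfold Rdiv; rewrite Rmult_assoc; apply Rmult_le_compat_l; [lra|].
    apply Rmult_le_reg_r with t; auto.
    replace (C * / t * t) with C by (field; lra).
    generalize (HCt t Ht); rewrite Rmult_1_l, pow_1; lra.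
Qed.

(** * Taylor expansions at the origin *)

(** Half-open, unlike [sum_n]: the empty sum is available for orders equal to 0. *)
Fixpoint rsum (f : nat -> R) (n : nat) : R :=
  match n with O => 0 | S k => rsum f k + f k end.

Lemma rsum_ext (f g : nat -> R) (n : nat) :
  (forall i, (i < n)%nat -> f i = g i) -> rsum f n = rsum g n.
Proof.
  induction n as [|n IH]; intros H; simpl; auto.
  rewrite H, IH; auto.
Qed.

Lemma rsum_scal (c : R) (f : nat -> R) (n : nat) : rsum (fun i => c * f i) n = c * rsum f n.
Proof. induction n as [|n IH]; simpl; [|rewrite IH]; ring. Qed.

Lemma rsum_plus (f g : nat -> R) (n : nat) :
  rsum (fun i => f i + g i) n = rsum f n + rsum g n.
Proof. induction n as [|n IH]; simpl; [|rewrite IH]; ring. Qed.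

Lemma rsum_S_l (f : nat -> R) (n : nat) : rsum f (S n) = f 0%nat + rsum (fun i => f (S i)) n.
Proof.
  induction n as [|n IH]; [simpl; ring|].
  change (rsum f (S n) + f (S n) = f 0%nat + (rsum (fun i => f (S i)) n + f (S n))).
  rewrite IH; ring.
Qed.

Lemma rsum_rev (f : nat -> R) (n : nat) :
  rsum (fun i => f (n - i)%nat) (S n) = rsum f (S n).
Proof.
  induction n as [|n IH]; [reflexivity|].
  rewrite rsum_S_l.
  rewrite (rsum_ext _ (fun i => f (n - i)%nat)) by (intros; f_equal; lia).
  rewrite IH; replace (S n - 0)%nat with (S n) by lia.
  change (rsum f (S (S n))) with (rsum f (S n) + f (S n)); ring.
Qed.

(* A Taylor expansion of [H 0] at [0+] with coefficients [q], [H k] being the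
   remainder of order [k] divided by [t ^ k]. *)
Definition taylor (H : nat -> R -> R) (q : nat -> R) : Prop :=
  (forall k t, 0 < t -> H k t = q k + t * H (S k) t) /\
  (forall k t, 0 < t -> continuous (H k) t) /\
  (forall k, exists M, forall t, 0 < t -> Rabs (H k t) <= M).

Lemma taylor_sum (H : nat -> R -> R) (q : nat -> R) (K : nat) (t : R) :
  taylor H q -> 0 < t -> H 0%nat t = rsum (fun k => q k * t ^ k) K + t ^ K * H K t.
Proof.
  intros [HS _] Ht; induction K as [|K IH]; simpl; [ring|].
  rewrite IH, (HS K t Ht); ring.
Qed.

(** * Entire power series and their quotients *)

Definition entire (a : nat -> R) : Prop := forall x : R, ex_pseries a x.

Lemma entire_continuous (a : nat -> R) (x : R) : entire a -> continuous (PSeries a) x.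
Proof.
  intros Ha; apply continuity_pt_filterlim, PSeries_continuity.
  apply Rbar_lt_le_trans with (Rabs x + 1); [simpl; lra|].
  (* With a radius of convergence below [|x| + 1], the terms at that point could not tend to 0. *)
  apply Rbar_not_lt_le; intros H.
  apply (CV_disk_outside a (Rabs x + 1)).
  - rewrite (Rabs_pos_eq (Rabs x + 1)) by (generalize (Rabs_pos x); lra); exact H.
  - apply ex_series_lim_0, (proj1 (ex_pseries_R a _)), Ha.
Qed.

Lemma entire_decr_1 (a : nat -> R) : entire a -> entire (PS_decr_1 a).
Proof.
  intros Ha x; apply ex_pseries_decr_1; [|apply Ha].
  destruct (Req_dec x 0) as [->|H]; [now left|right].
  exists (/ x); now apply Rinv_l.
Qed.

Lemma entire_minus_scal (a b : nat -> R) (c : R) :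
  entire a -> entire b -> entire (PS_minus a (PS_scal c b)).
Proof.
  intros Ha Hb x; apply (ex_pseries_minus (V := R_NormedModule)); [apply Ha|].
  apply (ex_pseries_scal (V := R_NormedModule)); [apply Rmult_comm | apply Hb].
Qed.

(* Division of power series: [series_rem a b k] is the remainder, divided by
   [t ^ k], of [a - b * sum_(i < k) series_quo a b i * t ^ i]. *)
Fixpoint series_rem (a b : nat -> R) (k : nat) : nat -> R :=
  match k with
  | O => a
  | S j => PS_decr_1 (PS_minus (series_rem a b j) (PS_scal (series_rem a b j 0%nat / b 0%nat) b))
  end.

Definition series_quo (a b : nat -> R) (k : nat) : R := series_rem a b k 0%nat / b 0%nat.

Lemma series_rem_entire (a b : nat -> R) (k : nat) :
  entire a -> entire b -> entire (series_rem a b k).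
Proof.
  intros Ha Hb; induction k as [|k IH]; auto.
  now apply entire_decr_1, entire_minus_scal.
Qed.

Lemma series_rem_S (a b : nat -> R) (k : nat) (t : R) :
  entire a -> entire b -> b 0%nat <> 0 ->
  PSeries (series_rem a b k) t
  = series_quo a b k * PSeries b t + t * PSeries (series_rem a b (S k)) t.
Proof.
  intros Ha Hb Hb0.
  assert (Hk := series_rem_entire a b k Ha Hb).
  generalize (PSeries_decr_1 _ t (entire_minus_scal _ b (series_quo a b k) Hk Hb t)).
  rewrite PSeries_minus, PSeries_scal; [|apply Hk|].
  2:{ apply (ex_pseries_scal (V := R_NormedModule)); [apply Rmult_comm | apply Hb]. }
  change (PS_decr_1 (PS_minus (series_rem a b k) (PS_scal (series_quo a b k) b)))
    with (series_rem a b (S k)).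
  (* The quotient is chosen to cancel the constant coefficient, which lets [t] be factored out. *)
  replace (PS_minus (series_rem a b k) (PS_scal (series_quo a b k) b) 0%nat) with 0.
  - intros; lra.
  - change (0 = series_rem a b k 0%nat - series_quo a b k * b 0%nat).
    unfold series_quo; field; auto.
Qed.

(** On [[0, 1]] the remainders are bounded by continuity, the denominator being nonzero at 0 too. On
    [[1, +oo[] the bound passes from order [k] to [k + 1], because [t * H (k + 1) t = H k t - q k]
    and [t >= 1]. *)
Lemma taylor_series_quo (a b : nat -> R) (M : R) :
  entire a -> entire b -> (forall t, 0 <= t -> PSeries b t <> 0) ->
  (forall t, 1 <= t -> Rabs (PSeries a t / PSeries b t) <= M) ->
  taylor (fun k t => PSeries (series_rem a b k) t / PSeries b t) (series_quo a b).
Proof.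
  intros Ha Hb Hb0 HM.
  assert (Hb00 : b 0%nat <> 0) by (rewrite <- PSeries_0; apply Hb0; lra).
  assert (HS : forall k t, 0 <= t ->
     PSeries (series_rem a b k) t / PSeries b t
     = series_quo a b k + t * (PSeries (series_rem a b (S k)) t / PSeries b t)).
  { intros k t Ht; rewrite (series_rem_S a b k t Ha Hb Hb00); field; auto. }
  assert (HC : forall k t, 0 <= t ->
     continuous (fun t => PSeries (series_rem a b k) t / PSeries b t) t).
  { intros k t Ht; apply (continuous_mult (K := R_AbsRing)).
    - now apply entire_continuous, series_rem_entire.
    - apply continuous_Rinv_comp; auto; now apply entire_continuous. }
  split; [|split].
  - intros; apply HS; lra.
  - intros; apply HC; lra.
  - intros k.
    assert (Hinf : exists M', forall t, 1 <= t ->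
       Rabs (PSeries (series_rem a b k) t / PSeries b t) <= M').
    { induction k as [|k [M' IH]]; [now exists M|].
      exists (M' + Rabs (series_quo a b k)); intros t Ht.
      assert (Rabs (t * (PSeries (series_rem a b (S k)) t / PSeries b t))
          <= M' + Rabs (series_quo a b k)).
      { replace (t * _) with (PSeries (series_rem a b k) t / PSeries b t - series_quo a b k)
          by (rewrite HS by lra; ring).
        apply Rle_trans with (1 := Rabs_triang _ _); rewrite Rabs_Ropp.
        apply Rplus_le_compat_r, IH; auto. }
      rewrite Rabs_mult, (Rabs_pos_eq t) in H by lra.
      generalize (Rabs_pos (PSeries (series_rem a b (S k)) t / PSeries b t)); nra. }
    destruct Hinf as [M1 HM1].
    destruct (bounded_continuity (V := R_NormedModule)
      (fun t => PSeries (series_rem a b k) t / PSeries b t) 0 1) as [M0 HM0].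
    { intros t Ht; apply HC; lra. }
    exists (Rmax M0 M1); intros t Ht; destruct (Rle_dec t 1) as [H|H].
    + apply Rle_trans with M0; [left; apply (HM0 t); lra | apply Rmax_l].
    + apply Rle_trans with M1; [apply HM1; lra | apply Rmax_r].
Qed.

Definition exp_coef (y : R) (i : nat) : R := (- y) ^ i / INR (fact i).

Lemma is_pseries_exp_coef (y t : R) : is_pseries (exp_coef y) t (exp (- (y * t))).
Proof.
  apply is_pseries_R.
  apply is_series_ext with (fun k => / INR (fact k) * (- (y * t)) ^ k).
  - intros k; unfold exp_coef.
    replace (- (y * t)) with (- y * t) by ring; rewrite Rpow_mult_distr; unfold Rdiv.
    match goal with |- @eq _ ?x ?z => change (x = z :> R) end; ring.
  - apply (proj1 (is_pseries_R (fun k => / INR (fact k)) _ _)), is_exp_Reals.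
Qed.

Lemma entire_exp_coef (y : R) : entire (exp_coef y).
Proof. intros x; eexists; apply is_pseries_exp_coef. Qed.

Lemma PSeries_exp_coef (y t : R) : PSeries (exp_coef y) t = exp (- (y * t)).
Proof. apply is_pseries_unique, is_pseries_exp_coef. Qed.

(** The denominator 1, which makes [exp (- t)] itself an instance of the division scheme. *)
Definition unit_series (i : nat) : R := match i with O => 1 | S _ => 0 end.

Lemma is_pseries_unit (t : R) : is_pseries unit_series t 1.
Proof.
  apply is_pseries_R; apply filterlim_ext with (fun _ => 1); [|apply filterlim_const].
  intros n; induction n as [|n IH].
  - rewrite sum_O; simpl; ring.
  - rewrite sum_Sn, <- IH. change (1 = 1 + 0 * t ^ S n); ring.
Qed.

Definition exp_rem (k : nat) (t : R) : R :=
  PSeries (series_rem (exp_coef 1) unit_series k) t / PSeries unit_series t.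

Lemma exp_rem_0 (t : R) : exp_rem 0 t = exp (- t).
Proof.
  unfold exp_rem; simpl; rewrite PSeries_exp_coef, (is_pseries_unique _ _ _ (is_pseries_unit t)).
  rewrite Rmult_1_l; field.
Qed.

Lemma series_quo_exp (k : nat) : series_quo (exp_coef 1) unit_series k = (-1) ^ k / INR (fact k).
Proof.
  assert (H : forall i, series_rem (exp_coef 1) unit_series k i = exp_coef 1 (k + i)).
  { induction k as [|k IH]; intros i; [reflexivity|].
    change (series_rem (exp_coef 1) unit_series k (S i)
       - series_rem (exp_coef 1) unit_series k 0 / 1 * 0 = exp_coef 1 (S k + i)).
    rewrite IH; replace (k + S i)%nat with (S k + i)%nat by lia; ring. }
  unfold series_quo; rewrite H, Nat.add_0_r; unfold exp_coef, unit_series.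
  replace (- (1)) with (-1) by ring; field; apply INR_fact_neq_0.
Qed.

Lemma taylor_exp : taylor exp_rem (fun k => (-1) ^ k / INR (fact k)).
Proof.
  assert (H1 : forall t, PSeries unit_series t = 1)
    by (intros; apply is_pseries_unique, is_pseries_unit).
  destruct (taylor_series_quo (exp_coef 1) unit_series 1) as [A [B C]].
  - apply entire_exp_coef.
  - intros x; eexists; apply is_pseries_unit.
  - intros; rewrite H1; lra.
  - intros t Ht; rewrite H1, PSeries_exp_coef.
    rewrite Rdiv_1_r, Rmult_1_l.
    rewrite Rabs_pos_eq by (apply Rlt_le, exp_pos).
    rewrite <- exp_0; left; apply exp_increasing; lra.
  - split; [|split]; auto.
    intros; rewrite <- series_quo_exp; apply A; auto.
Qed.

(* The power series of [(1 - exp (- (m * t))) / t]. *)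
Definition den_coef (m : R) : nat -> R := PS_opp (PS_decr_1 (exp_coef m)).

Lemma entire_den_coef (m : R) : entire (den_coef m).
Proof.
  intros x; apply (ex_pseries_opp (V := R_NormedModule)), entire_decr_1, entire_exp_coef.
Qed.

Lemma PSeries_den_coef (m t : R) : t * PSeries (den_coef m) t = 1 - exp (- (m * t)).
Proof.
  unfold den_coef; rewrite PSeries_opp.
  generalize (PSeries_decr_1 _ t (entire_exp_coef m t)); rewrite PSeries_exp_coef.
  replace (exp_coef m 0) with 1 by (unfold exp_coef; simpl; field).
  intros; lra.
Qed.

Lemma PSeries_den_coef_neq_0 (m t : R) : 0 < m -> 0 <= t -> PSeries (den_coef m) t <> 0.
Proof.
  intros Hm [Ht|<-] H.
  - generalize (PSeries_den_coef m t); rewrite H.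
    assert (exp (- (m * t)) < 1) by (rewrite <- exp_0; apply exp_increasing; nra). lra.
  - rewrite PSeries_0 in H.
    change (- exp_coef m 1 = 0) in H; unfold exp_coef in H; simpl in H; lra.
Qed.

(** At order 0 this is [t * G p t]. Its coefficient [geom_coef m p k] is [(-1) ^ k * m ^ (k - 1) *
    B_k (p / m) / k!], with [B_k] the Bernoulli polynomial. *)
Definition geom_rem (m p : R) (k : nat) (t : R) : R :=
  PSeries (series_rem (exp_coef p) (den_coef m) k) t / PSeries (den_coef m) t.

Definition geom_coef (m p : R) : nat -> R := series_quo (exp_coef p) (den_coef m).

Lemma geom_rem_0 (m p t : R) :
  0 < m -> 0 < t -> geom_rem m p 0 t = t * exp (- (p * t)) / (1 - exp (- (m * t))).
Proof.
  intros Hm Ht; unfold geom_rem; simpl; rewrite PSeries_exp_coef, <- PSeries_den_coef.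
  field; split; [apply PSeries_den_coef_neq_0|]; lra.
Qed.

Lemma taylor_geom (m p : R) : 0 < m -> 0 < p -> taylor (geom_rem m p) (geom_coef m p).
Proof.
  intros Hm Hp.
  destruct (pow_mul_exp_bounded 1 p Hp) as [C [HC H]].
  assert (Hm1 : exp (- m) < 1) by (rewrite <- exp_0; apply exp_increasing; lra).
  (* For [t >= 1] the numerator [t * exp (- (p * t))] is at most [C] and the denominator at least
     [1 - exp (- m)]. *)
  apply taylor_series_quo with (C / (1 - exp (- m))).
  - apply entire_exp_coef.
  - apply entire_den_coef.
  - intros; now apply PSeries_den_coef_neq_0.
  - intros t Ht.
    change (Rabs (geom_rem m p 0 t) <= C / (1 - exp (- m))).
    rewrite geom_rem_0 by lra.
    assert (exp (- (m * t)) <= exp (- m)).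
    { destruct Ht as [Ht| <-]; [left; apply exp_increasing; nra | rewrite Rmult_1_r; lra]. }
    rewrite Rabs_pos_eq.
    2:{ apply Rmult_le_pos; [apply Rmult_le_pos; [lra|apply Rlt_le, exp_pos]|].
        apply Rlt_le, Rinv_0_lt_compat; lra. }
    apply Rmult_le_compat.
    + apply Rmult_le_pos; [lra|apply Rlt_le, exp_pos].
    + apply Rlt_le, Rinv_0_lt_compat; lra.
    + generalize (H t ltac:(lra)); rewrite pow_1; auto.
    + apply Rinv_le_contravar; lra.
Qed.

(* The regularised integrand: the counterterm [exp (- t)] makes it bounded at
   [0] without spoiling its decay at infinity. *)
Definition regularized (H : nat -> R -> R) (q : nat -> R) (k : nat) (t : R) : R :=
  (H k t - q k * exp (- t)) / t.

Lemma regularized_continuous (H : nat -> R -> R) (q : nat -> R) (k : nat) (t : R) :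
  taylor H q -> 0 < t -> continuous (regularized H q k) t.
Proof.
  intros [_ [HC _]] Ht; unfold regularized.
  apply (continuous_mult (K := R_AbsRing)).
  - apply (continuous_minus (V := R_NormedModule)); [now apply HC|].
    apply (ex_derive_continuous (V := R_NormedModule)); auto_derive; auto.
  - apply (ex_derive_continuous (V := R_NormedModule)); auto_derive; lra.
Qed.

Lemma one_minus_exp_div_bounds (t : R) : 0 < t -> 0 <= (1 - exp (- t)) / t <= 1.
Proof.
  intros Ht.
  assert (exp (- t) < 1) by (rewrite <- exp_0; apply exp_increasing; lra).
  generalize (exp_ineq1_le (- t)); intros.
  split.
  - apply Rlt_le, Rdiv_lt_0_compat; lra.
  - apply Rmult_le_reg_r with t; auto.
    replace ((1 - exp (- t)) / t * t) with (1 - exp (- t)) by (field; lra). lra.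
Qed.

Lemma exp_neg_le_inv (t : R) : 0 < t -> exp (- t) <= / t.
Proof.
  intros Ht; rewrite exp_Ropp; apply Rinv_le_contravar; auto.
  generalize (exp_ineq1_le t); lra.
Qed.

(** Substituting [H k t = q k + t * H (k + 1) t] leaves [H (k + 1) t + q k * (1 - exp (- t)) / t],
    bounded on the whole half line. *)
Lemma regularized_near_0 (H : nat -> R -> R) (q : nat -> R) (k : nat) :
  taylor H q -> exists M, 0 <= M /\ forall t, 0 < t -> Rabs (regularized H q k t) <= M.
Proof.
  intros [HS [_ HB]]; destruct (HB (S k)) as [M HM].
  exists (M + Rabs (q k)); split.
  { generalize (HM 1 Rlt_0_1) (Rabs_pos (H (S k) 1)) (Rabs_pos (q k)); lra. }
  intros t Ht; unfold regularized; rewrite HS by auto.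
  replace ((q k + t * H (S k) t - q k * exp (- t)) / t)
    with (H (S k) t + q k * ((1 - exp (- t)) / t)) by (field; lra).
  apply Rle_trans with (1 := Rabs_triang _ _), Rplus_le_compat; auto.
  rewrite Rabs_mult.
  destruct (one_minus_exp_div_bounds t Ht) as [H1 H2]; rewrite (Rabs_pos_eq _ H1).
  generalize (Rabs_pos (q k)); nra.
Qed.

(** Decay at infinity comes from the recursion read backwards, [H (k + 1) t = (H k t - q k) / t],
    which makes the integrand [O(1 / t ^ 2)]. Order 0 has no predecessor, hence the index [S k]. *)
Lemma ex_RInt_regularized (H : nat -> R -> R) (q : nat -> R) (k : nat) :
  taylor H q -> exists l, is_half_line_RInt (regularized H q (S k)) l.
Proof.
  intros HT; destruct (regularized_near_0 H q (S k) HT) as [M0 [HM0 HM0']].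
  assert (HS := proj1 HT); destruct (proj2 (proj2 HT) k) as [M HM].
  set (M1 := M + Rabs (q k) + Rabs (q (S k))).
  apply ex_half_line_RInt_decay with (Rmax M0 M1).
  - intros; now apply regularized_continuous.
  - intros t Ht; apply Rle_trans with M0; [apply HM0'; lra | apply Rmax_l].
  - intros t Ht.
    apply Rle_trans with (M1 / t ^ 2).
    2:{ apply Rmult_le_compat_r; [|apply Rmax_r].
        apply Rlt_le, Rinv_0_lt_compat, pow_lt; lra. }
    unfold regularized.
    replace ((H (S k) t - q (S k) * exp (- t)) / t)
      with ((H k t - q k - q (S k) * (t * exp (- t))) / t ^ 2)
      by (rewrite (HS k t) by lra; field; lra).
    unfold Rdiv; rewrite Rabs_mult, (Rabs_pos_eq (/ t ^ 2)).
    2:{ apply Rlt_le, Rinv_0_lt_compat, pow_lt; lra. }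
    apply Rmult_le_compat_r; [apply Rlt_le, Rinv_0_lt_compat, pow_lt; lra|].
    unfold M1, Rminus.
    apply Rle_trans with (1 := Rabs_triang _ _).
    apply Rplus_le_compat.
    + apply Rle_trans with (1 := Rabs_triang _ _); rewrite Rabs_Ropp.
      apply Rplus_le_compat_r, HM; lra.
    + rewrite Rabs_Ropp, Rabs_mult.
      assert (0 <= t * exp (- t) <= 1).
      { split; [apply Rmult_le_pos; [lra | apply Rlt_le, exp_pos]|].
        generalize (exp_neg_le_inv t ltac:(lra)); intros H2.
        apply Rmult_le_compat_l with (r := t) in H2; [|lra].
        rewrite Rinv_r in H2; lra. }
      rewrite (Rabs_pos_eq (t * _)) by lra.
      generalize (Rabs_pos (q (S k))); nra.
Qed.

(** * Sums of logarithms over an arithmetic progression *)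

Lemma rsum_abs_le (f : nat -> R) (n : nat) : Rabs (rsum f n) <= rsum (fun i => Rabs (f i)) n.
Proof.
  induction n as [|n IH]; simpl; [rewrite Rabs_R0; lra|].
  apply Rle_trans with (1 := Rabs_triang _ _); lra.
Qed.

Lemma rsum_le (f g : nat -> R) (n : nat) :
  (forall i, (i < n)%nat -> f i <= g i) -> rsum f n <= rsum g n.
Proof.
  induction n as [|n IH]; intros H; simpl; [lra|].
  apply Rplus_le_compat; auto.
Qed.

Lemma rsum_eq0 (f : nat -> R) (n : nat) : (forall i, (i < n)%nat -> f i = 0) -> rsum f n = 0.
Proof.
  induction n as [|n IH]; intros H; simpl; auto.
  rewrite H, IH; auto; lra.
Qed.

Lemma half_line_RInt_rsum (f : nat -> R -> R) (l : nat -> R) (n : nat) :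
  (forall i, (i < n)%nat -> is_half_line_RInt (f i) (l i)) ->
  is_half_line_RInt (fun t => rsum (fun i => f i t) n) (rsum l n).
Proof.
  induction n as [|n IH]; intros H; simpl.
  - apply half_line_RInt_const0.
  - apply half_line_RInt_plus; auto.
Qed.

Lemma ex_bound_rsum (f : nat -> R -> R) (n : nat) :
  (forall i, (i < n)%nat -> exists M, forall t, 0 < t -> Rabs (f i t) <= M) ->
  exists M, forall t, 0 < t -> Rabs (rsum (fun i => f i t) n) <= M.
Proof.
  induction n as [|n IH]; intros H; simpl.
  - exists 0; intros; rewrite Rabs_R0; lra.
  - destruct IH as [M1 H1]; auto; destruct (H n) as [M2 H2]; auto.
    exists (M1 + M2); intros t Ht; apply Rle_trans with (1 := Rabs_triang _ _).
    apply Rplus_le_compat; auto.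
Qed.

Lemma null_of_linear_bound (c C : R) : (forall t, 0 < t <= 1 -> Rabs c <= C * t) -> c = 0.
Proof.
  intros H.
  destruct (Req_dec c 0) as [|Hc]; auto; exfalso.
  assert (0 < Rabs c) by now apply Rabs_pos_lt.
  assert (HC : 0 < C) by (generalize (H 1 ltac:(lra)); lra).
  (* At [t = |c| / (2 * C)] the bound would read [|c| <= |c| / 2]. *)
  assert (Hm : 0 < Rabs c / (2 * C)) by (apply Rdiv_lt_0_compat; lra).
  generalize (H 1 ltac:(lra)); intros H1.
  assert (Rabs c / (2 * C) <= 1).
  { apply Rmult_le_reg_r with (2 * C); [lra|].
    replace (Rabs c / (2 * C) * (2 * C)) with (Rabs c) by (field; lra). lra. }
  generalize (H (Rabs c / (2 * C)) ltac:(lra)).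
  replace (C * (Rabs c / (2 * C))) with (Rabs c / 2) by (field; lra). lra.
Qed.

(** As [t] tends to 0 the constant term must vanish; the rest is [t] times a shorter polynomial,
    which satisfies the same bound one order lower. *)
Lemma poly_small_null (N : nat) (c : nat -> R) (C : R) :
  (forall t, 0 < t <= 1 -> Rabs (rsum (fun k => c k * t ^ k) N) <= C * t ^ N) ->
  forall k, (k < N)%nat -> c k = 0.
Proof.
  revert c; induction N as [|N IH]; intros c H k Hk; [lia|].
  assert (HS : forall t, rsum (fun k => c k * t ^ k) (S N)
     = c 0%nat + t * rsum (fun k => c (S k) * t ^ k) N).
  { intros t; rewrite rsum_S_l, <- rsum_scal; simpl (t ^ 0); rewrite Rmult_1_r; f_equal.
    apply rsum_ext; intros; simpl; ring. }
  assert (H0 : c 0%nat = 0).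
  { apply null_of_linear_bound with (Rabs C + rsum (fun k => Rabs (c (S k))) N).
    intros t Ht.
    generalize (H t Ht); rewrite HS; intros H1.
    replace (c 0%nat) with ((c 0%nat + t * rsum (fun k => c (S k) * t ^ k) N)
      - t * rsum (fun k => c (S k) * t ^ k) N) by ring.
    apply Rle_trans with (1 := Rabs_triang _ _).
    rewrite Rabs_Ropp, Rabs_mult, (Rabs_pos_eq t) by lra.
    rewrite Rmult_plus_distr_r; apply Rplus_le_compat.
    - apply Rle_trans with (1 := H1).
      assert (0 <= t ^ N <= 1).
      { split; [apply pow_le; lra|].
        rewrite <- (pow1 N); apply pow_incr; lra. }
      apply Rle_trans with (Rabs C * (t * t ^ N)).
      + apply Rmult_le_compat_r; [nra | apply Rle_abs].
      + apply Rmult_le_compat_l; [apply Rabs_pos | nra].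
    - rewrite Rmult_comm; apply Rmult_le_compat_r; [lra|].
      apply Rle_trans with (1 := rsum_abs_le _ _), rsum_le; intros i _.
      rewrite Rabs_mult, (Rabs_pos_eq (t ^ i)) by (apply pow_le; lra).
      assert (t ^ i <= 1) by (rewrite <- (pow1 i); apply pow_incr; lra).
      generalize (Rabs_pos (c (S i))); nra. }
  destruct k as [|k]; auto.
  apply (IH (fun k => c (S k))); [|lia].
  intros t Ht; generalize (H t Ht); rewrite HS, H0, Rplus_0_l, Rabs_mult, (Rabs_pos_eq t) by lra.
  simpl; intros H1; apply Rmult_le_reg_l with t; lra.
Qed.

Definition is_poly (N : nat) (f : R -> R) : Prop :=
  exists c : nat -> R, forall t, f t = rsum (fun k => c k * t ^ k) N.

Lemma is_poly_plus (N : nat) (f g : R -> R) :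
  is_poly N f -> is_poly N g -> is_poly N (fun t => f t + g t).
Proof.
  intros [a Ha] [b Hb]; exists (fun k => a k + b k); intros t.
  rewrite Ha, Hb, <- rsum_plus; apply rsum_ext; intros; ring.
Qed.

Lemma is_poly_scal (N : nat) (c : R) (f : R -> R) :
  is_poly N f -> is_poly N (fun t => c * f t).
Proof.
  intros [a Ha]; exists (fun k => c * a k); intros t.
  rewrite Ha, <- rsum_scal; apply rsum_ext; intros; ring.
Qed.

Lemma is_poly_pow (N k : nat) : (k < N)%nat -> is_poly N (fun t => t ^ k).
Proof.
  intros Hk; exists (fun i => if Nat.eq_dec i k then 1 else 0); intros t.
  induction N as [|N IH]; [lia|]; simpl.
  destruct (Nat.eq_dec N k) as [->|H].
  - rewrite rsum_eq0; [ring|]; intros i Hi; destruct (Nat.eq_dec i k); [lia | ring].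
  - rewrite <- IH by lia; ring.
Qed.

Lemma is_poly_rsum (N : nat) (f : nat -> R -> R) (n : nat) :
  (forall i, (i < n)%nat -> is_poly N (f i)) -> is_poly N (fun t => rsum (fun i => f i t) n).
Proof.
  induction n as [|n IH]; intros H; simpl.
  - exists (fun _ => 0); intros; rewrite rsum_eq0; auto; intros; ring.
  - apply is_poly_plus; auto.
Qed.

Lemma is_poly_ext (N : nat) (f g : R -> R) :
  (forall t, f t = g t) -> is_poly N f -> is_poly N g.
Proof. intros H [c Hc]; exists c; intros; rewrite <- H; auto. Qed.

(** Replacing [exp (- t)] by 1 costs [O(t ^ (n + 2))]. The right-hand side becomes a polynomial of
    degree at most [n + 1] that is [O(t ^ (n + 2))] at 0, hence zero: [Q] and [d] vanish
    together. *)
Lemma laurent_bounded_null (n : nat) (Q D : R -> R) (d M : R) :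
  is_poly (S n) Q ->
  (forall t, 0 < t -> t ^ S (S n) * D t = Q t + d * t ^ S n * exp (- t)) ->
  (forall t, 0 < t -> Rabs (D t) <= M) ->
  d = 0 /\ forall t, 0 < t -> D t = 0.
Proof.
  intros [c Hc] HD HM.
  set (c' := fun k => if Nat.eq_dec k (S n) then d else c k).
  assert (Hc' : forall t, rsum (fun k => c' k * t ^ k) (S (S n)) = Q t + d * t ^ S n).
  { intros t; rewrite Hc.
    change (rsum (fun k => c' k * t ^ k) (S n) + c' (S n) * t ^ S n
      = rsum (fun k => c k * t ^ k) (S n) + d * t ^ S n).
    f_equal.
    - apply rsum_ext; intros i Hi; unfold c'; destruct (Nat.eq_dec i (S n)); [lia | auto].
    - unfold c'; destruct (Nat.eq_dec (S n) (S n)); [auto | lia]. }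
  assert (H0 : forall k, (k < S (S n))%nat -> c' k = 0).
  { apply poly_small_null with (M + Rabs d); intros t Ht; rewrite Hc'.
    replace (Q t + d * t ^ S n)
      with (t ^ S (S n) * (D t + d * ((1 - exp (- t)) / t))).
    2:{ rewrite Rmult_plus_distr_l, HD by lra; simpl; field; lra. }
    rewrite Rabs_mult, (Rabs_pos_eq (t ^ _)), Rmult_comm by (apply pow_le; lra).
    apply Rmult_le_compat_r; [apply pow_le; lra|].
    apply Rle_trans with (1 := Rabs_triang _ _), Rplus_le_compat; [apply HM; lra|].
    destruct (one_minus_exp_div_bounds t ltac:(lra)) as [H1 H2].
    rewrite Rabs_mult, (Rabs_pos_eq _ H1); generalize (Rabs_pos d); nra. }
  assert (Hd : d = 0).
  { rewrite <- (H0 (S n)) by lia; unfold c'; destruct (Nat.eq_dec (S n) (S n)); [auto | lia]. }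
  split; auto; intros t Ht.
  apply Rmult_eq_reg_l with (t ^ S (S n)); [|apply pow_nonzero; lra].
  rewrite HD by auto; generalize (Hc' t).
  rewrite rsum_eq0 by (intros; rewrite H0; auto; ring).
  rewrite Hd; intros H1; lra.
Qed.

(** * The logarithmic kernel and its sums *)

Definition exp_tc (k : nat) : R := (-1) ^ k / INR (fact k).

Lemma exp_tc_neq_0 (k : nat) : exp_tc k <> 0.
Proof.
  unfold exp_tc, Rdiv; apply Rmult_integral_contrapositive; split.
  - apply pow_nonzero; lra.
  - apply Rinv_neq_0_compat, INR_fact_neq_0.
Qed.

(* A regularisation of [exp (- (y * t)) / t ^ (n + 1)]; its integral is a
   combination of [y ^ n] and [y ^ n * ln y]. *)
Definition log_kernel (n : nat) (y t : R) : R :=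
  y ^ S n * regularized exp_rem exp_tc n (y * t)
  + exp_tc n * y ^ n * ((exp (- (y * t)) - exp (- t)) / t).

(** The Frullani part trades the rescaled counterterm [exp (- (y * t))] for [exp (- t)], the same
    for every [y], so that kernels at different [y] can be added. *)
Lemma log_kernel_eq (n : nat) (y t : R) : 0 < y -> 0 < t ->
  t ^ S n * log_kernel n y t
  = exp (- (y * t)) - rsum (fun i => exp_tc i * (y * t) ^ i) n - exp_tc n * (y * t) ^ n * exp (- t).
Proof.
  intros Hy Ht; unfold log_kernel, regularized.
  assert (Hyt : 0 < y * t) by nra.
  generalize (taylor_sum exp_rem exp_tc n (y * t) taylor_exp Hyt); rewrite exp_rem_0; intros H.
  rewrite H at 3; rewrite !Rpow_mult_distr; simpl; field; lra.
Qed.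

Definition exp_const (n : nat) : R :=
  RInt_gen (V := R_CompleteNormedModule) (regularized exp_rem exp_tc n) (at_right 0) (Rbar_locally p_infty).

Lemma exp_const_spec (n : nat) : is_half_line_RInt (regularized exp_rem exp_tc n) (exp_const n).
Proof.
  assert (H : exists l, is_half_line_RInt (regularized exp_rem exp_tc n) l).
  { destruct n as [|n].
    (* At order 0 the function equals its counterterm and the integrand is 0. *)
    - exists 0; generalize half_line_RInt_const0; apply half_line_RInt_eq; auto.
      intros t Ht; unfold regularized; rewrite exp_rem_0; unfold exp_tc; simpl; field; lra.
    - apply ex_RInt_regularized, taylor_exp. }
  exact (RInt_gen_correct (V := R_CompleteNormedModule) _ H).
Qed.

Definition log_value (n : nat) (y : R) : R := exp_const n * y ^ n - exp_tc n * y ^ n * ln y.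

Lemma log_kernel_RInt (n : nat) (y : R) :
  1 <= y -> is_half_line_RInt (log_kernel n y) (log_value n y).
Proof.
  intros Hy.
  generalize (half_line_RInt_plus _ _ _ _
    (half_line_RInt_scal (y ^ n) _ _ (half_line_RInt_scale _ y _ ltac:(lra) (exp_const_spec n)))
    (half_line_RInt_scal (- (exp_tc n * y ^ n)) _ _ (frullani_exp y Hy))).
  apply half_line_RInt_eq.
  - intros t Ht; unfold log_kernel; simpl; field; lra.
  - unfold log_value; ring.
Qed.

Lemma log_kernel_bounded (n : nat) (y : R) :
  1 <= y -> exists M, forall t, 0 < t -> Rabs (log_kernel n y t) <= M.
Proof.
  intros Hy.
  destruct (regularized_near_0 exp_rem exp_tc n taylor_exp) as [M [HM H]].
  exists (Rabs (y ^ S n) * M + Rabs (exp_tc n * y ^ n) * y); intros t Ht.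
  assert (Hyt : 0 < y * t) by nra.
  unfold log_kernel; apply Rle_trans with (1 := Rabs_triang _ _).
  rewrite !(Rabs_mult (y ^ S n)), (Rabs_mult (exp_tc n * y ^ n)).
  apply Rplus_le_compat; apply Rmult_le_compat_l; try apply Rabs_pos; auto.
  destruct (one_minus_exp_div_bounds (y * t) Hyt) as [H1 H2].
  assert (exp (- (y * t)) <= exp (- t)).
  { destruct Hy as [Hy| <-]; [left; apply exp_increasing; nra | rewrite Rmult_1_l; lra]. }
  assert (exp (- t) < 1) by (rewrite <- exp_0; apply exp_increasing; lra).
  replace ((exp (- (y * t)) - exp (- t)) / t) with (- ((exp (- t) - exp (- (y * t))) / t))
    by (field; lra).
  rewrite Rabs_Ropp, Rabs_pos_eq.
  2:{ apply Rmult_le_pos; [lra | apply Rlt_le, Rinv_0_lt_compat; lra]. }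
  apply Rle_trans with ((1 - exp (- (y * t))) / t).
  - apply Rmult_le_compat_r; [apply Rlt_le, Rinv_0_lt_compat|]; lra.
  - replace ((1 - exp (- (y * t))) / t) with (y * ((1 - exp (- (y * t))) / (y * t))) by (field; lra).
    nra.
Qed.

Lemma geometric_sum_exp (m p t : R) (n : nat) : 0 < m -> 0 < t ->
  rsum (fun j => exp (- ((p + m * INR j) * t))) n
  = (exp (- (p * t)) - exp (- ((p + m * INR n) * t))) / (1 - exp (- (m * t))).
Proof.
  intros Hm Ht.
  assert (exp (- (m * t)) < 1) by (rewrite <- exp_0; apply exp_increasing; nra).
  induction n as [|n IH]; simpl rsum.
  - replace ((p + m * INR 0) * t) with (p * t) by (simpl; ring); field; lra.
  - rewrite IH, S_INR.
    replace (- ((p + m * (INR n + 1)) * t)) with (- ((p + m * INR n) * t) + - (m * t)) by ring.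
    rewrite exp_plus; field; lra.
Qed.

Lemma progression_ge1 (m p : R) (j : nat) : 0 < m -> 1 <= p -> 1 <= p + m * INR j.
Proof. generalize (pos_INR j); nra. Qed.

(** [y + p'] is the first point of the progression left out. The geometric sum removes every
    exponential but the counterterm from [t ^ (n + 2)] times the difference [D] of the two sides,
    leaving a polynomial [Q] of degree at most [n] plus [d * t ^ (n + 1) * exp (- t)]. As [D] is
    bounded, [laurent_bounded_null] gives both conclusions: [d = 0] is the power sum, [D = 0] the
    identity of integrands. *)
Lemma log_kernel_sum (m p p' y : R) (n sigma : nat) :
  0 < m -> 1 <= p -> 1 <= p' -> 1 <= y -> p + m * INR sigma = y + p' ->
  let yj j := p + m * INR j in
  exp_tc n * rsum (fun j => yj j ^ n) sigma
  = geom_coef m p (S n)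
    - rsum (fun k => geom_coef m p' k * (exp_tc (S n - k) * y ^ (S n - k))) (S (S n)) /\
  forall t, 0 < t ->
  rsum (fun j => log_kernel n (yj j) t) sigma
  = regularized (geom_rem m p) (geom_coef m p) (S n) t
    - rsum (fun k => geom_coef m p' k * log_kernel (S n - k) y t) (S (S n))
    - exp (- (y * t)) * geom_rem m p' (S (S n)) t.
Proof.
  intros Hm Hp Hp' Hy Hend yj; set (g := geom_coef m p); set (g' := geom_coef m p').
  assert (HT : taylor (geom_rem m p) g) by (apply taylor_geom; lra).
  assert (HT' : taylor (geom_rem m p') g') by (apply taylor_geom; lra).
  set (D := fun t => rsum (fun j => log_kernel n (yj j) t) sigma
    - (regularized (geom_rem m p) g (S n) t
    - rsum (fun k => g' k * log_kernel (S n - k) y t) (S (S n))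
    - exp (- (y * t)) * geom_rem m p' (S (S n)) t)).
  set (Q := fun t => rsum (fun j => - t * rsum (fun i => exp_tc i * (yj j * t) ^ i) n) sigma
    + (rsum (fun k => g k * t ^ k) (S n)
    + rsum (fun k => - g' k * (t ^ k * rsum (fun i => exp_tc i * (y * t) ^ i) (S n - k))) (S (S n)))).
  (* [d] collects the counterterms in [exp (- t)] of the three kinds of regularised terms. *)
  set (d := g (S n) - rsum (fun k => g' k * (exp_tc (S n - k) * y ^ (S n - k))) (S (S n))
    - exp_tc n * rsum (fun j => yj j ^ n) sigma).
  destruct (regularized_near_0 _ g (S n) HT) as [M1 [_ HM1]].
  destruct (ex_bound_rsum (fun j => log_kernel n (yj j)) sigma) as [M2 HM2].
  { intros j _; apply (log_kernel_bounded n (yj j)); now apply progression_ge1. }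
  destruct (ex_bound_rsum (fun k t => g' k * log_kernel (S n - k) y t) (S (S n))) as [M3 HM3].
  { intros k _; destruct (log_kernel_bounded (S n - k) y Hy) as [M HM].
    exists (Rabs (g' k) * M); intros t Ht; rewrite Rabs_mult.
    apply Rmult_le_compat_l; [apply Rabs_pos | auto]. }
  destruct (proj2 (proj2 HT') (S (S n))) as [M4 HM4].
  destruct (laurent_bounded_null n Q D d (M2 + (M1 + M3 + M4))) as [H1 H2].
  - apply is_poly_plus; [|apply is_poly_plus].
    + apply is_poly_rsum; intros j _.
      apply is_poly_ext with (fun t => rsum (fun i => - exp_tc i * yj j ^ i * t ^ S i) n).
      * intros t; rewrite <- rsum_scal; apply rsum_ext; intros; rewrite Rpow_mult_distr; simpl; ring.
      * apply is_poly_rsum; intros; apply is_poly_scal, is_poly_pow; lia.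
    + apply is_poly_rsum; intros; apply is_poly_scal, is_poly_pow; lia.
    + apply is_poly_rsum; intros k _; apply is_poly_scal.
      apply is_poly_ext with (fun t => rsum (fun i => exp_tc i * y ^ i * t ^ (k + i)) (S n - k)).
      * intros t; rewrite <- rsum_scal; apply rsum_ext; intros.
        rewrite Rpow_mult_distr, pow_add; ring.
      * apply is_poly_rsum; intros; apply is_poly_scal, is_poly_pow; lia.
  - intros t Ht.
    assert (E1 : t ^ S (S n) * rsum (fun j => log_kernel n (yj j) t) sigma
      = t * rsum (fun j => exp (- (yj j * t))) sigma
        + rsum (fun j => - t * rsum (fun i => exp_tc i * (yj j * t) ^ i) n) sigma
        + - (exp_tc n * t ^ S n * exp (- t)) * rsum (fun j => yj j ^ n) sigma).
    { rewrite <- !rsum_scal, <- !rsum_plus; apply rsum_ext; intros j _.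
      change (t ^ S (S n)) with (t * t ^ S n); rewrite Rmult_assoc, log_kernel_eq; auto.
      - rewrite (Rpow_mult_distr (yj j) t n); simpl; ring.
      - generalize (progression_ge1 m p j Hm Hp); unfold yj; lra. }
    (* Splitting [t ^ (n + 2)] as [t ^ k * t ^ (n + 2 - k)] matches the denominator of the kernel of
       index [n + 1 - k]. *)
    assert (E2 : t ^ S (S n) * rsum (fun k => g' k * log_kernel (S n - k) y t) (S (S n))
      = exp (- (y * t)) * rsum (fun k => g' k * t ^ k) (S (S n))
        + rsum (fun k => - g' k * (t ^ k * rsum (fun i => exp_tc i * (y * t) ^ i) (S n - k))) (S (S n))
        + - (t ^ S n * exp (- t)) * rsum (fun k => g' k * (exp_tc (S n - k) * y ^ (S n - k))) (S (S n))).
    { rewrite <- !rsum_scal, <- !rsum_plus; apply rsum_ext; intros k Hk.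
      replace (t ^ S (S n)) with (t ^ k * t ^ S (S n - k)) by (rewrite <- pow_add; f_equal; lia).
      replace (t ^ S n) with (t ^ k * t ^ (S n - k)) by (rewrite <- pow_add; f_equal; lia).
      replace (t ^ k * t ^ S (S n - k) * (g' k * log_kernel (S n - k) y t))
        with (g' k * t ^ k * (t ^ S (S n - k) * log_kernel (S n - k) y t)) by ring.
      rewrite log_kernel_eq by lra.
      rewrite (Rpow_mult_distr y t (S n - k)); ring. }
    assert (E3 : t ^ S (S n) * regularized (geom_rem m p) g (S n) t
      = geom_rem m p 0 t - rsum (fun k => g k * t ^ k) (S n) - t ^ S n * g (S n) * exp (- t)).
    { rewrite (taylor_sum _ g (S n) t HT Ht); unfold regularized; simpl; field; lra. }
    assert (E4 := taylor_sum _ g' (S (S n)) t HT' Ht).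
    assert (E5 : t * rsum (fun j => exp (- (yj j * t))) sigma
      = geom_rem m p 0 t - exp (- (y * t)) * geom_rem m p' 0 t).
    { unfold yj; rewrite geometric_sum_exp, Hend, !geom_rem_0 by lra.
      replace (- ((y + p') * t)) with (- (y * t) + - (p' * t)) by ring; rewrite exp_plus.
      assert (exp (- (m * t)) < 1) by (rewrite <- exp_0; apply exp_increasing; nra).
      field; lra. }
    unfold D, Q, d.
    rewrite !Rmult_minus_distr_l, E1, E2, E3, E5.
    replace (t ^ S (S n) * (exp (- (y * t)) * geom_rem m p' (S (S n)) t))
      with (exp (- (y * t)) * (geom_rem m p' 0 t - rsum (fun k => g' k * t ^ k) (S (S n))))
      by (rewrite E4; ring).
    ring.
  - intros t Ht; unfold D.
    apply Rle_trans with (1 := Rabs_triang _ _); apply Rplus_le_compat; auto.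
    rewrite Rabs_Ropp; unfold Rminus.
    apply Rle_trans with (1 := Rabs_triang _ _); apply Rplus_le_compat.
    + apply Rle_trans with (1 := Rabs_triang _ _); apply Rplus_le_compat; auto.
      rewrite Rabs_Ropp; auto.
    + rewrite Rabs_Ropp, Rabs_mult, (Rabs_pos_eq (exp _)) by (apply Rlt_le, exp_pos).
      assert (exp (- (y * t)) < 1) by (rewrite <- exp_0; apply exp_increasing; nra).
      generalize (HM4 t Ht) (exp_pos (- (y * t))) (Rabs_pos (geom_rem m p' (S (S n)) t)); nra.
  - split; [unfold d in H1; lra|].
    intros t Ht; generalize (H2 t Ht); unfold D; lra.
Qed.

Definition geom_const (m p : R) (n : nat) : R :=
  RInt_gen (V := R_CompleteNormedModule) (regularized (geom_rem m p) (geom_coef m p) (S n))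
    (at_right 0) (Rbar_locally p_infty).

Lemma geom_const_spec (m p : R) (n : nat) : 0 < m -> 1 <= p ->
  is_half_line_RInt (regularized (geom_rem m p) (geom_coef m p) (S n)) (geom_const m p n).
Proof.
  intros Hm Hp.
  apply (RInt_gen_correct (V := R_CompleteNormedModule)), ex_RInt_regularized, taylor_geom; lra.
Qed.

(** The sum of the kernels is integrated twice, term by term and through [log_kernel_sum], and
    uniqueness of the integral equates the results. *)
Lemma log_sum_formula (m p p' y : R) (n sigma : nat) (W : R) :
  0 < m -> 1 <= p -> 1 <= p' -> 1 <= y -> p + m * INR sigma = y + p' ->
  let yj j := p + m * INR j in
  is_half_line_RInt (fun t => exp (- (y * t)) * geom_rem m p' (S (S n)) t) W ->
  exp_tc n * rsum (fun j => yj j ^ n * ln (yj j)) sigma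
  = exp_const n * rsum (fun j => yj j ^ n) sigma
    - geom_const m p n + rsum (fun k => geom_coef m p' k * log_value (S n - k) y) (S (S n)) + W.
Proof.
  intros Hm Hp Hp' Hy Hend yj HW.
  destruct (log_kernel_sum m p p' y n sigma) as [_ H]; auto.
  assert (E : rsum (fun j => log_value n (yj j)) sigma
    = geom_const m p n - rsum (fun k => geom_coef m p' k * log_value (S n - k) y) (S (S n)) - W).
  { apply half_line_RInt_unique with (fun t => rsum (fun j => log_kernel n (yj j) t) sigma).
    - apply (half_line_RInt_rsum (fun j => log_kernel n (yj j)) (fun j => log_value n (yj j))).
      intros j _; apply log_kernel_RInt; now apply progression_ge1.
    - eapply half_line_RInt_eq; [intros t Ht; symmetry; now apply H | reflexivity |].
      apply half_line_RInt_minus; auto; apply half_line_RInt_minus; [now apply geom_const_spec|].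
      apply (half_line_RInt_rsum (fun k t => geom_coef m p' k * log_kernel (S n - k) y t)).
      intros k _; now apply half_line_RInt_scal, log_kernel_RInt. }
  assert (E' : rsum (fun j => log_value n (yj j)) sigma
    = exp_const n * rsum (fun j => yj j ^ n) sigma
      + - exp_tc n * rsum (fun j => yj j ^ n * ln (yj j)) sigma).
  { rewrite <- !rsum_scal, <- rsum_plus; apply rsum_ext; intros; unfold log_value; ring. }
  lra.
Qed.

Lemma ex_laplace_taylor (H : nat -> R -> R) (q : nat -> R) (k : nat) (y : R) :
  taylor H q -> 1 <= y -> exists W, is_half_line_RInt (fun t => exp (- (y * t)) * H k t) W.
Proof.
  intros [_ [HC HB]] Hy; destruct (HB k) as [M HM].
  assert (HM0 : 0 <= M) by (apply Rle_trans with (2 := HM 1 Rlt_0_1), Rabs_pos).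
  destruct (pow_mul_exp_bounded 2 1 Rlt_0_1) as [C [HC0 HCt]].
  apply ex_half_line_RInt_decay with (M * (1 + C)).
  - intros t Ht; apply (continuous_mult (K := R_AbsRing)); auto.
    apply (ex_derive_continuous (V := R_NormedModule)); auto_derive; auto.
  - intros t Ht; rewrite Rabs_mult, (Rabs_pos_eq (exp _)) by (apply Rlt_le, exp_pos).
    assert (exp (- (y * t)) < 1) by (rewrite <- exp_0; apply exp_increasing; nra).
    generalize (HM t ltac:(lra)) (exp_pos (- (y * t))) (Rabs_pos (H k t)); nra.
  - intros t Ht; rewrite Rabs_mult, (Rabs_pos_eq (exp _)), Rmult_comm by (apply Rlt_le, exp_pos).
    unfold Rdiv; rewrite Rmult_assoc; apply Rmult_le_compat.
    + apply Rabs_pos.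
    + apply Rlt_le, exp_pos.
    + apply HM; lra.
    + assert (Ht2 : 0 < t ^ 2) by (apply pow_lt; lra).
      apply Rmult_le_reg_l with (t ^ 2); auto.
      replace (t ^ 2 * ((1 + C) * / t ^ 2)) with (1 + C) by (field; lra).
      assert (exp (- (y * t)) <= exp (- (1 * t))).
      { destruct Hy as [Hy| <-]; [left; apply exp_increasing; nra | lra]. }
      generalize (HCt t ltac:(lra)); nra.
Qed.

(** Subtracting [K] terms is exact: the difference is the integral of
    [t ^ K * exp (- (y * t)) * H (k + K) t]. Bounding [H (k + K)] leaves a multiple of
    [K! / y ^ (K + 1)], with a constant independent of [y]. *)
Lemma watson_lemma (H : nat -> R -> R) (q : nat -> R) (k K : nat) :
  taylor H q -> exists C, forall y W : R, 1 <= y ->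
  is_half_line_RInt (fun t => exp (- (y * t)) * H k t) W ->
  Rabs (W - rsum (fun i => q (k + i)%nat * INR (fact i) / y ^ S i) K) <= C / y ^ S K.
Proof.
  intros HT; destruct (proj2 (proj2 HT) (k + K)%nat) as [M HM].
  exists (M * INR (fact K)); intros y W Hy HW.
  assert (E : is_half_line_RInt (fun t => t ^ K * exp (- (y * t)) * H (k + K)%nat t)
     (W - rsum (fun i => q (k + i)%nat * INR (fact i) / y ^ S i) K)).
  { clear M HM; induction K as [|K IH].
    - revert HW; apply half_line_RInt_eq; [intros t Ht; rewrite Nat.add_0_r|]; simpl; ring.
    - generalize (half_line_RInt_minus _ _ _ _ IH
        (half_line_RInt_scal (q (k + K)%nat) _ _ (half_line_RInt_pow_exp K y ltac:(lra)))).
      apply half_line_RInt_eq.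
      + intros t Ht; rewrite (proj1 HT (k + K)%nat t Ht), <- plus_n_Sm; simpl; ring.
      + simpl; unfold Rdiv; ring. }
  replace (M * INR (fact K) / y ^ S K) with (M * (INR (fact K) / y ^ S K)) by (unfold Rdiv; ring).
  apply half_line_RInt_norm_le with (2 := E)
    (3 := half_line_RInt_scal M _ _ (half_line_RInt_pow_exp K y ltac:(lra))).
  intros t Ht; rewrite Rabs_mult, Rabs_pos_eq, Rmult_comm.
  - apply Rmult_le_compat_r; auto.
    apply Rmult_le_pos; [apply pow_le; lra | apply Rlt_le, exp_pos].
  - apply Rmult_le_pos; [apply pow_le; lra | apply Rlt_le, exp_pos].
Qed.

(** * The asymptotic expansion of a residue class *)

(** Each residue class has an expansion with real coefficients; [chi] enters afterwards, by
    linearity. *)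
Definition has_real_expansion (u : nat -> R) (J : nat) (a : nat -> R) (b : Z -> R) : Prop :=
  forall N : nat,
    is_lim_seq
      (fun s : nat =>
         (u s - rsum (fun j => a j * (INR s ^ j * ln (INR s))) (S J)
          - rsum (fun i => b (Z.of_nat i - Z.of_nat N)%Z
                           * powerRZ (INR s) (Z.of_nat i - Z.of_nat N)) (S (J + N)))
         * INR s ^ N) 0.

Lemma is_lim_seq_0_of_inv_bound (u : nat -> R) (C : R) :
  (forall s, (1 <= s)%nat -> Rabs (u s) <= C / INR s) -> is_lim_seq u 0.
Proof.
  intros H.
  assert (HC : is_lim_seq (fun s => C / INR s) 0).
  { replace 0 with (C * 0) by ring.
    apply (is_lim_seq_scal_l (fun s => / INR s) C 0).
    apply (is_lim_seq_inv INR p_infty); [apply is_lim_seq_INR | discriminate]. }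
  apply is_lim_seq_le_le_loc with (fun s => - (C / INR s)) (fun s => C / INR s); auto.
  - exists 1%nat; intros s Hs; apply Rabs_le_between; auto.
  - replace 0 with (- 0) by ring; now apply (is_lim_seq_opp _ 0).
Qed.

(** [w i] belongs to the exponent [- (i + 1)], the indexing that Watson's lemma produces; hence
    [pred]. *)
Definition laurent_coef (beta w : nat -> R) (z : Z) : R :=
  match z with
  | Z0 => beta 0%nat
  | Zpos p => beta (Pos.to_nat p)
  | Zneg p => w (pred (Pos.to_nat p))
  end.

Lemma laurent_coef_nat (beta w : nat -> R) (i : nat) : laurent_coef beta w (Z.of_nat i) = beta i.
Proof. destruct i as [|i]; simpl; auto; now rewrite SuccNat2Pos.id_succ. Qed.

Lemma laurent_coef_neg (beta w : nat -> R) (i : nat) :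
  laurent_coef beta w (- Z.of_nat (S i)) = w i.
Proof. simpl; now rewrite SuccNat2Pos.id_succ. Qed.

Lemma laurent_sum (beta w : nat -> R) (J N : nat) (x : R) :
  rsum (fun i => laurent_coef beta w (Z.of_nat i - Z.of_nat N)
                 * powerRZ x (Z.of_nat i - Z.of_nat N)) (S (J + N))
  = rsum (fun j => beta j * x ^ j) (S J) + rsum (fun i => w i / x ^ S i) N.
Proof.
  induction N as [|N IH].
  - rewrite Nat.add_0_r, Rplus_0_r; apply rsum_ext; intros i _.
    rewrite Z.sub_0_r, laurent_coef_nat, <- pow_powerRZ; auto.
  - replace (S (J + S N)) with (S (S (J + N))) by lia.
    rewrite rsum_S_l.
    rewrite (rsum_ext _ (fun i => laurent_coef beta w (Z.of_nat i - Z.of_nat N)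
                 * powerRZ x (Z.of_nat i - Z.of_nat N))).
    2:{ intros i _; replace (Z.of_nat (S i) - Z.of_nat (S N))%Z
          with (Z.of_nat i - Z.of_nat N)%Z by lia; auto. }
    rewrite IH.
    replace (Z.of_nat 0 - Z.of_nat (S N))%Z with (- Z.of_nat (S N))%Z by lia.
    rewrite laurent_coef_neg, powerRZ_neg', <- pow_powerRZ.
    change (rsum (fun i => w i / x ^ S i) (S N))
      with (rsum (fun i => w i / x ^ S i) N + w N / x ^ S N); unfold Rdiv; ring.
Qed.

(** At order [N] the tail is cut after its first [N] terms, and the error [C / s ^ (N + 1)] times
    [s ^ N] is [C / s]. *)
Lemma has_real_expansion_of_tail (u W : nat -> R) (J : nat) (alpha beta w : nat -> R) :
  (forall s, (1 <= s)%nat ->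
     u s = rsum (fun j => alpha j * (INR s ^ j * ln (INR s))) (S J)
           + rsum (fun j => beta j * INR s ^ j) (S J) + W s) ->
  (forall K, exists C, forall s, (1 <= s)%nat ->
     Rabs (W s - rsum (fun i => w i / INR s ^ S i) K) <= C / INR s ^ S K) ->
  has_real_expansion u J alpha (laurent_coef beta w).
Proof.
  intros Hu HW N; destruct (HW N) as [C HC].
  apply is_lim_seq_0_of_inv_bound with C; intros s Hs.
  assert (H1 : 1 <= INR s) by (apply (le_INR 1); auto).
  rewrite laurent_sum, (Hu s Hs).
  assert (Hp : 0 < INR s ^ N) by (apply pow_lt; lra).
  match goal with |- Rabs (?x * _) <= _ =>
    replace x with (W s - rsum (fun i => w i / INR s ^ S i) N) by ring end.
  rewrite Rabs_mult, (Rabs_pos_eq (INR s ^ N)) by lra.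
  replace (C / INR s) with (C / INR s ^ S N * INR s ^ N) by (simpl; field; lra).
  apply Rmult_le_compat_r; auto; lra.
Qed.

(** [e] counts the extra terms of a class that meets the incomplete last period. *)
Definition residue_log_sum (n m r e s : nat) : R :=
  rsum (fun j => (INR r + INR m * INR j) ^ n * ln (INR r + INR m * INR j)) (s + e).

(* The integrand of the constant term of [residue_log_sum n m r e]. *)
Definition residue_integrand (n m r e : nat) (t : R) : R :=
  let g := geom_coef (INR m) (INR r) in
  let g' := geom_coef (INR m) (INR (r + m * e)) in
  / exp_tc n * (g' (S n) * log_kernel 0 (INR m) t
    + / exp_tc n * (g (S n) - g' (S n)) * regularized exp_rem exp_tc n t
    - regularized (geom_rem (INR m) (INR r)) g (S n) t).

(** The constant term is [F = / exp_tc n] times the sum of three pieces: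
    [g' (n + 1) * log_value 0 m], left by the kernel of order 0 at [m * s] once [ln s] is split off;
    [exp_const n] times the constant term [F * (g (n + 1) - g' (n + 1))] of the power sum; and
    [- geom_const m p n]. *)
Lemma residue_log_sum_expansion (n m r e : nat) : (1 <= m)%nat -> (1 <= r)%nat ->
  exists a b, has_real_expansion (residue_log_sum n m r e) (S n) a b /\
    is_half_line_RInt (residue_integrand n m r e) (b 0%Z).
Proof.
  intros Hm Hr.
  set (M := INR m); set (p := INR r); set (p' := INR (r + m * e)).
  assert (HM : 1 <= M) by (apply (le_INR 1); auto).
  assert (Hp : 1 <= p) by (apply (le_INR 1); auto).
  assert (Hp' : 1 <= p') by (apply (le_INR 1); lia).
  assert (HM0 : 0 < M) by lra.
  set (g := geom_coef M p); set (g' := geom_coef M p').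
  set (F := / exp_tc n).
  assert (HT' : taylor (geom_rem M p') g') by (apply taylor_geom; lra).
  set (h := fun s : nat => fun t => exp (- (M * INR s * t)) * geom_rem M p' (S (S n)) t).
  set (W := fun s : nat => RInt_gen (V := R_CompleteNormedModule) (h s) (at_right 0) (Rbar_locally p_infty)).
  assert (Hs1 : forall s, (1 <= s)%nat -> 1 <= M * INR s).
  { intros s Hs; assert (1 <= INR s) by (apply (le_INR 1); auto); nra. }
  assert (HW : forall s, (1 <= s)%nat -> is_half_line_RInt (h s) (W s)).
  { intros s Hs; apply (RInt_gen_correct (V := R_CompleteNormedModule)).
    apply (ex_laplace_taylor _ g' (S (S n)) (M * INR s)); auto. }
  (* [kappa] gathers the terms outside the sum over [j]; [beta] adds them at [j = 0]. *)
  set (kappa := F * (F * exp_const n * g (S n) - geom_const M p n)).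
  set (alpha := fun j => - F * (g' (S n - j)%nat * exp_tc j * M ^ j)).
  set (beta0 := fun j => F * (g' (S n - j)%nat * M ^ j * (exp_const j - exp_tc j * ln M)
     - F * exp_const n * g' (S n - j)%nat * exp_tc j * M ^ j)).
  set (beta := fun j => beta0 j + match j with O => kappa | S _ => 0 end).
  set (w := fun i => F * (g' (S (S n) + i)%nat * INR (fact i) / M ^ S i)).
  exists alpha, (laurent_coef beta w); split.
  - apply has_real_expansion_of_tail with (fun s => F * W s).
    + intros s Hs.
      assert (Hsp : 1 <= INR s) by (apply (le_INR 1); auto).
      assert (Hend : p + M * INR (s + e) = M * INR s + p').
      { unfold p, p', M; rewrite !plus_INR, mult_INR; ring. }
      destruct (log_kernel_sum M p p' (M * INR s) n (s + e)) as [HP _]; auto.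
      assert (HL := log_sum_formula M p p' (M * INR s) n (s + e) (W s) HM0 Hp Hp' (Hs1 s Hs) Hend (HW s Hs)).
      cbv zeta in HP, HL; fold g in HP; fold g' in HP, HL.
      (* Reindexing by the exponent [j = n + 1 - k] of [s]. *)
      assert (Hrev : forall v : nat -> R, rsum (fun k => g' k * v (S n - k)%nat) (S (S n))
         = rsum (fun j => g' (S n - j)%nat * v j) (S (S n))).
      { intros v; rewrite <- (rsum_rev (fun k => g' k * v (S n - k)%nat) (S n)).
        apply rsum_ext; intros i Hi; do 2 f_equal; lia. }
      rewrite (Hrev (fun j => log_value j (M * INR s))) in HL.
      rewrite (Hrev (fun j => exp_tc j * (M * INR s) ^ j)) in HP.
      assert (Hbeta : rsum (fun j => beta j * INR s ^ j) (S (S n))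
         = rsum (fun j => beta0 j * INR s ^ j) (S (S n)) + kappa).
      { rewrite !(rsum_S_l _ (S n)), (rsum_ext _ (fun i => beta0 (S i) * INR s ^ S i)).
        - unfold beta; simpl (INR s ^ 0); ring.
        - intros i _; unfold beta; ring. }
      rewrite Hbeta.
      assert (HF : F * exp_tc n = 1) by (apply Rinv_l, exp_tc_neq_0).
      assert (Hterm : rsum (fun j => alpha j * (INR s ^ j * ln (INR s))) (S (S n))
          + rsum (fun j => beta0 j * INR s ^ j) (S (S n))
        = F * rsum (fun j => g' (S n - j)%nat * log_value j (M * INR s)) (S (S n))
          + - (F * F * exp_const n)
            * rsum (fun j => g' (S n - j)%nat * (exp_tc j * (M * INR s) ^ j)) (S (S n))).
      { rewrite <- !rsum_scal, <- !rsum_plus; apply rsum_ext; intros j _.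
        unfold alpha, beta0, log_value; rewrite ln_mult, Rpow_mult_distr by lra; ring. }
      replace (residue_log_sum n m r e s) with (F * (exp_tc n * residue_log_sum n m r e s))
        by (rewrite <- Rmult_assoc, HF; ring).
      unfold residue_log_sum; fold p M; rewrite HL.
      rewrite <- Rplus_assoc, Hterm; unfold kappa.
      (* The power sum that multiplies [exp_const n] is replaced by its closed form. *)
      match type of HP with _ * ?P = _ => replace P with (F * (exp_tc n * P))
        by (rewrite <- Rmult_assoc, HF; ring) end.
      rewrite HP; ring.
    + intros K; destruct (watson_lemma _ g' (S (S n)) K HT') as [C HC].
      exists (Rabs F * (C / M ^ S K)); intros s Hs.
      assert (Hsp : 1 <= INR s) by (apply (le_INR 1); auto).
      generalize (HC (M * INR s) (W s) (Hs1 s Hs) (HW s Hs)); intros H.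
      replace (F * W s - rsum (fun i => w i / INR s ^ S i) K)
        with (F * (W s - rsum (fun i => g' (S (S n) + i)%nat * INR (fact i) / (M * INR s) ^ S i) K)).
      2:{ rewrite Rmult_minus_distr_l; f_equal; rewrite <- rsum_scal; apply rsum_ext; intros i _.
          unfold w; rewrite Rpow_mult_distr; field; split; apply pow_nonzero; lra. }
      rewrite Rabs_mult; unfold Rdiv at 2; rewrite Rmult_assoc.
      apply Rmult_le_compat_l; [apply Rabs_pos|].
      replace (C / M ^ S K * / INR s ^ S K) with (C / (M * INR s) ^ S K); auto.
      rewrite Rpow_mult_distr; field; split; apply pow_nonzero; lra.
  - unfold laurent_coef, beta, beta0, kappa, residue_integrand; fold M p p' g g' F.
    generalize (half_line_RInt_scal F _ _
      (half_line_RInt_minus _ _ _ _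
        (half_line_RInt_plus _ _ _ _
          (half_line_RInt_scal (g' (S n)) _ _ (log_kernel_RInt 0 M HM))
          (half_line_RInt_scal (F * (g (S n) - g' (S n))) _ _ (exp_const_spec n)))
        (geom_const_spec M p n HM0 Hp))).
    apply half_line_RInt_eq; [reflexivity|].
    unfold log_value; rewrite Nat.sub_0_r; replace (exp_tc 0) with 1 by (unfold exp_tc; simpl; field).
    simpl (M ^ 0); ring.
Qed.

(** * Finite complex sums *)

Fixpoint csum (f : nat -> C) (n : nat) : C :=
  match n with O => RtoC 0 | S k => (csum f k + f k)%C end.

Lemma sum_n_csum (f : nat -> C) (n : nat) : sum_n f n = csum f (S n).
Proof.
  induction n as [|n IH].
  - rewrite sum_O; simpl; ring.
  - rewrite sum_Sn, IH; reflexivity.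
Qed.

Lemma csum_ext (f g : nat -> C) (n : nat) :
  (forall i, (i < n)%nat -> f i = g i) -> csum f n = csum g n.
Proof.
  induction n as [|n IH]; intros H; simpl; auto.
  rewrite H, IH; auto.
Qed.

Lemma csum_plus (f g : nat -> C) (n : nat) :
  csum (fun i => f i + g i)%C n = (csum f n + csum g n)%C.
Proof. induction n as [|n IH]; simpl; [|rewrite IH]; ring. Qed.

Lemma csum_scal (c : C) (f : nat -> C) (n : nat) :
  csum (fun i => c * f i)%C n = (c * csum f n)%C.
Proof. induction n as [|n IH]; simpl; [|rewrite IH]; ring. Qed.

Lemma csum_eq0 (f : nat -> C) (n : nat) :
  (forall i, (i < n)%nat -> f i = RtoC 0) -> csum f n = RtoC 0.
Proof.
  induction n as [|n IH]; intros H; simpl; auto.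
  rewrite H, IH; auto; ring.
Qed.

Lemma csum_add (f : nat -> C) (a b : nat) :
  csum f (a + b) = (csum f a + csum (fun i => f (a + i)%nat) b)%C.
Proof.
  induction b as [|b IH]; [rewrite Nat.add_0_r; simpl; ring|].
  rewrite <- plus_n_Sm; simpl; rewrite IH; ring.
Qed.

Lemma csum_pad (f : nat -> C) (n N : nat) : (n <= N)%nat ->
  (forall i, (n <= i)%nat -> f i = RtoC 0) -> csum f N = csum f n.
Proof.
  intros H Hf; replace N with (n + (N - n))%nat by lia.
  rewrite csum_add, (csum_eq0 (fun i => f (n + i)%nat)); [ring|].
  intros; apply Hf; lia.
Qed.

Lemma csum_S_l (f : nat -> C) (n : nat) :
  csum f (S n) = (f 0%nat + csum (fun i => f (S i)) n)%C.
Proof. rewrite <- (Nat.add_1_l n), csum_add; simpl; ring. Qed.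

(** * Uniqueness of the constant term *)

Lemma is_lim_seq_rsum0 (f : nat -> nat -> R) (n : nat) :
  (forall j, (j < n)%nat -> is_lim_seq (f j) 0) ->
  is_lim_seq (fun s => rsum (fun j => f j s) n) 0.
Proof.
  induction n as [|n IH]; intros H; simpl.
  - apply is_lim_seq_const.
  - replace (Finite 0) with (Rbar_plus 0 0) by (simpl; f_equal; ring).
    apply is_lim_seq_plus'; auto.
Qed.

Lemma is_lim_seq_ln_div : is_lim_seq (fun s => ln (INR s) / INR s) 0.
Proof.
  apply (is_lim_comp_seq (fun y => ln y / y) INR p_infty 0).
  - apply is_lim_div_ln_p.
  - exists 0%nat; intros; discriminate.
  - apply is_lim_seq_INR.
Qed.

Lemma is_lim_seq_inv_INR : is_lim_seq (fun s => / INR s) 0.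
Proof. apply (is_lim_seq_inv INR p_infty); [apply is_lim_seq_INR | discriminate]. Qed.

Lemma is_lim_seq_0_bounded_mult (u v : nat -> R) :
  (forall s, (1 <= s)%nat -> Rabs (u s) <= 1) -> is_lim_seq v 0 ->
  is_lim_seq (fun s => u s * v s) 0.
Proof.
  intros Hu Hv; apply is_lim_seq_abs_0; apply is_lim_seq_abs_0 in Hv.
  apply is_lim_seq_le_le_loc with (3 := Hv) (u := fun _ => 0); [|apply is_lim_seq_const].
  exists 1%nat; intros s Hs; rewrite Rabs_mult; split.
  - apply Rmult_le_pos; apply Rabs_pos.
  - generalize (Hu s Hs) (Rabs_pos (v s)); nra.
Qed.

(** Comparing the sequence at [2 * s] and at [s] isolates [A * ln 2]. *)
Lemma ln_affine_null (A B : R) : is_lim_seq (fun s => A * ln (INR s) + B) 0 -> A = 0 /\ B = 0.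
Proof.
  intros H.
  assert (H2 : is_lim_seq (fun s => A * ln (INR (2 * s)) + B) 0).
  { apply (is_lim_seq_subseq (fun s => A * ln (INR s) + B) 0 (fun s => 2 * s)%nat); auto.
    apply eventually_subseq; intros; lia. }
  assert (HA : A * ln 2 = 0).
  { assert (H3 : is_lim_seq (fun _ => A * ln 2) (Finite (0 - 0))).
    { apply is_lim_seq_ext_loc with (2 := is_lim_seq_minus' _ _ _ _ H2 H).
      exists 1%nat; intros s Hs; rewrite mult_INR, ln_mult; [|simpl; lra|].
      2: apply (lt_INR 0); lia.
      replace (INR 2) with 2 by (simpl; ring); ring. }
    generalize (is_lim_seq_unique _ _ H3); rewrite Lim_seq_const; intros E; injection E; lra. }
  assert (A = 0).
  { apply Rmult_integral in HA; destruct HA as [|HA]; auto.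
    generalize ln_lt_2; lra. }
  split; auto; subst A.
  assert (H3 : is_lim_seq (fun _ => B) 0).
  { apply is_lim_seq_ext with (2 := H); intros; ring. }
  generalize (is_lim_seq_unique _ _ H3); rewrite Lim_seq_const; intros E; injection E; auto.
Qed.

(** Division by [s ^ (J + 1)] leaves [A * ln s + B] from the top degree and sends all lower terms to
    0; the top pair vanishes and the degree drops. *)
Lemma ln_poly_null (J : nat) (A B : nat -> R) :
  is_lim_seq (fun s => rsum (fun j => A j * (INR s ^ j * ln (INR s)) + B j * INR s ^ j) (S J)) 0 ->
  forall j, (j <= J)%nat -> A j = 0 /\ B j = 0.
Proof.
  induction J as [|J IH]; intros H j Hj.
  - replace j with 0%nat by lia; apply ln_affine_null.
    apply is_lim_seq_ext with (2 := H); intros s; simpl; ring.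
  - set (T := fun j s => A j * (INR s ^ j * ln (INR s)) + B j * INR s ^ j).
    change (is_lim_seq (fun s => rsum (fun j => T j s) (S J) + T (S J) s) 0) in H.
    assert (Hinv : forall k s, (1 <= s)%nat -> (k <= J)%nat -> Rabs (INR s ^ k / INR s ^ J) <= 1).
    { intros k s Hs Hk; assert (1 <= INR s) by (apply (le_INR 1); auto).
      assert (0 < INR s ^ k) by (apply pow_lt; lra).
      assert (0 < INR s ^ J) by (apply pow_lt; lra).
      rewrite Rabs_pos_eq by (apply Rlt_le, Rdiv_lt_0_compat; auto).
      apply Rmult_le_reg_r with (INR s ^ J); auto.
      unfold Rdiv; rewrite Rmult_assoc, Rinv_l, Rmult_1_l, Rmult_1_r by lra.
      now apply Rle_pow. }
    assert (Hlow : forall k, (k < S J)%nat -> is_lim_seq (fun s => T k s / INR s ^ S J) 0).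
    { intros k Hk.
      apply is_lim_seq_ext_loc with (fun s => (INR s ^ k / INR s ^ J)
        * (A k * (ln (INR s) / INR s) + B k * / INR s)).
      - exists 1%nat; intros s Hs; assert (1 <= INR s) by (apply (le_INR 1); auto).
        assert (INR s ^ J <> 0) by (apply pow_nonzero; lra).
        unfold T; simpl; field; split; auto; lra.
      - apply is_lim_seq_0_bounded_mult.
        + intros; apply Hinv; lia.
        + replace (Finite 0) with (Rbar_plus (A k * 0) (B k * 0)) by (simpl; f_equal; ring).
          apply is_lim_seq_plus'.
          * apply (is_lim_seq_scal_l _ (A k) 0), is_lim_seq_ln_div.
          * apply (is_lim_seq_scal_l _ (B k) 0), is_lim_seq_inv_INR. }
    assert (Htop : A (S J) = 0 /\ B (S J) = 0).
    { apply ln_affine_null.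
      assert (H1 : is_lim_seq (fun s => 1 / INR s ^ S J * (rsum (fun j => T j s) (S J) + T (S J) s)) 0).
      { apply is_lim_seq_0_bounded_mult; auto.
        intros s Hs; assert (1 <= INR s) by (apply (le_INR 1); auto).
        assert (1 <= INR s ^ S J) by (apply pow_R1_Rle; auto).
        rewrite Rabs_pos_eq by (apply Rlt_le, Rdiv_lt_0_compat; lra).
        apply Rmult_le_reg_r with (INR s ^ S J); [lra|].
        unfold Rdiv; rewrite Rmult_assoc, Rinv_l, Rmult_1_l; lra. }
      generalize (is_lim_seq_minus' _ _ _ _ H1
        (is_lim_seq_rsum0 (fun k s => T k s / INR s ^ S J) (S J) Hlow)).
      rewrite Rminus_0_r; apply is_lim_seq_ext_loc.
      exists 1%nat; intros s Hs; assert (1 <= INR s) by (apply (le_INR 1); auto).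
      assert (INR s ^ S J <> 0) by (apply pow_nonzero; lra).
      rewrite (rsum_ext (fun j => T j s / INR s ^ S J) (fun j => / INR s ^ S J * T j s))
        by (intros; unfold Rdiv; ring).
      rewrite rsum_scal; unfold T at 2; field; auto. }
    destruct (Nat.eq_dec j (S J)) as [->|Hne]; auto.
    apply IH; [|lia].
    apply is_lim_seq_ext with (2 := H); intros s; unfold T; rewrite (proj1 Htop), (proj2 Htop).
    ring.
Qed.

Lemma real_functional_csum (L : C -> R) (f : nat -> C) (x : nat -> R) (n : nat) :
  L (RtoC 0) = 0 -> (forall z w, L (z + w)%C = L z + L w) ->
  (forall z r, L (z * RtoC r)%C = L z * r) ->
  L (csum (fun i => f i * RtoC (x i))%C n) = rsum (fun i => L (f i) * x i) n.
Proof.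
  intros L0 Lp Ls; induction n as [|n IH]; simpl; auto.
  now rewrite Lp, Ls, IH.
Qed.

Lemma rsum_pad (f : nat -> R) (n N : nat) : (n <= N)%nat ->
  rsum (fun i => if le_lt_dec n i then 0 else f i) N = rsum f n.
Proof.
  intros H; induction N as [|N IH].
  - replace n with 0%nat by lia; reflexivity.
  - simpl; destruct (le_lt_dec n N) as [H1|H1].
    + rewrite IH by lia; ring.
    + assert (n = S N) by lia; subst n.
      change (rsum f (S N)) with (rsum f N + f N); f_equal.
      apply rsum_ext; intros i Hi; destruct (le_lt_dec (S N) i); [lia | reflexivity].
Qed.

(* [L] will be [Re] and [Im]. *)
Lemma constant_term_functional_unique (L : C -> R) (u : nat -> C) (c c' : C) :
  L (RtoC 0) = 0 -> (forall z w, L (z + w)%C = L z + L w) ->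
  (forall z r, L (z * RtoC r)%C = L z * r) -> (forall z, Rabs (L z) <= Cmod z) ->
  is_constant_term u c -> is_constant_term u c' -> L c = L c'.
Proof.
  intros L0 Lp Ls Lb [J [a [b [H <-]]]] [J' [a' [b' [H' <-]]]].
  assert (Lm : forall z w, L (z - w)%C = L z - L w).
  { intros z w; replace (z - w)%C with (z + w * RtoC (-1))%C.
    - rewrite Lp, Ls; ring.
    - apply injective_projections; simpl; ring. }
  (* The expansion at [N = 0] is enough: it contains the constant term and its error is [o(1)]. *)
  assert (HL : forall J a b, has_expansion u J a b ->
    is_lim_seq (fun s => L (u s) - rsum (fun j => L (a j) * (INR s ^ j * ln (INR s))
      + L (b (Z.of_nat j)) * INR s ^ j) (S J)) 0).
  { clear - L0 Lp Ls Lb Lm; intros J a b H; specialize (H 0%nat).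
    apply is_lim_seq_abs_0.
    apply is_lim_seq_le_le_loc with (3 := H) (u := fun _ => 0); [|apply is_lim_seq_const].
    exists 0%nat; intros s _; split; [apply Rabs_pos|].
    rewrite pow_O, Rmult_1_r.
    eapply Rle_trans; [|apply Lb]; right; f_equal.
    rewrite Nat.add_0_r, !sum_n_csum, !Lm, !real_functional_csum, rsum_plus by auto.
    rewrite (rsum_ext (fun i => L (b (Z.of_nat i - Z.of_nat 0)%Z) * _)
      (fun j => L (b (Z.of_nat j)) * INR s ^ j)); [ring|].
    intros i _; rewrite Z.sub_0_r, <- pow_powerRZ; auto. }
  (* The two expansions may have different [J]; both are padded with zeros to a common length. *)
  set (N := S (max J J')).
  set (A := fun j => (if le_lt_dec (S J) j then 0 else L (a j))
    - (if le_lt_dec (S J') j then 0 else L (a' j))).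
  set (B := fun j => (if le_lt_dec (S J) j then 0 else L (b (Z.of_nat j)))
    - (if le_lt_dec (S J') j then 0 else L (b' (Z.of_nat j)))).
  destruct (ln_poly_null (max J J') A B) with (j := 0%nat) as [_ H0]; [|lia|].
  - generalize (is_lim_seq_minus' _ _ _ _ (HL J' a' b' H') (HL J a b H)).
    rewrite Rminus_0_r; apply is_lim_seq_ext; intros s; fold N.
    rewrite <- (rsum_pad _ (S J) N), <- (rsum_pad _ (S J') N) by (unfold N; lia).
    match goal with |- ?x - rsum ?f N - (?x - rsum ?g N) = _ =>
      replace (x - rsum f N - (x - rsum g N)) with (rsum g N + -1 * rsum f N) by ring end.
    rewrite <- rsum_scal, <- rsum_plus; apply rsum_ext; intros j _; unfold A, B.
    destruct (le_lt_dec (S J) j), (le_lt_dec (S J') j); ring.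
  - unfold B in H0; destruct (le_lt_dec (S J) 0), (le_lt_dec (S J') 0); try lia.
    simpl in H0; lra.
Qed.

Lemma constant_term_unique (u : nat -> C) (c c' : C) :
  is_constant_term u c -> is_constant_term u c' -> c = c'.
Proof.
  intros H H'; apply injective_projections.
  - apply (constant_term_functional_unique Re u); auto.
    + intros z r; unfold Cmult, Re; simpl; ring.
    + intros z; apply Rle_trans with (2 := Rmax_Cmod z), Rmax_l.
  - apply (constant_term_functional_unique Im u); auto.
    + intros z r; unfold Cmult, Im; simpl; ring.
    + intros z; apply Rle_trans with (2 := Rmax_Cmod z), Rmax_r.
Qed.

Lemma constant_term_eq (u : nat -> C) (c : C) : is_constant_term u c -> constant_term u = c.
Proof.
  intros H; apply (iota_unique (V := C_R_CompleteNormedModule)); auto.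
  intros y Hy; now apply constant_term_unique with u.
Qed.

(** * Recombination of the residue classes *)

Lemma RtoC_rsum (f : nat -> R) (n : nat) : RtoC (rsum f n) = csum (fun i => RtoC (f i)) n.
Proof. induction n as [|n IH]; simpl; auto; now rewrite RtoC_plus, IH. Qed.

Lemma has_expansion_plus (u v : nat -> C) (J : nat) (a a' : nat -> C) (b b' : Z -> C) :
  has_expansion u J a b -> has_expansion v J a' b' ->
  has_expansion (fun s => u s + v s)%C J (fun j => a j + a' j)%C (fun z => b z + b' z)%C.
Proof.
  intros H H' N; specialize (H N); specialize (H' N).
  generalize (is_lim_seq_plus' _ _ _ _ H H'); rewrite Rplus_0_r; intros HS.
  apply is_lim_seq_le_le_loc with (3 := HS) (u := fun _ => 0); [|apply is_lim_seq_const].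
  exists 0%nat; intros s _.
  assert (Hp : 0 <= INR s ^ N) by apply pow_le, pos_INR.
  split; [apply Rmult_le_pos; [apply Cmod_ge_0 | auto]|].
  rewrite <- Rmult_plus_distr_r; apply Rmult_le_compat_r; auto.
  eapply Rle_trans; [|apply Cmod_triangle]; right; f_equal.
  rewrite !sum_n_csum.
  rewrite (csum_ext (fun j => (a j + a' j) * RtoC (INR s ^ j * ln (INR s)))%C
    (fun j => a j * RtoC (INR s ^ j * ln (INR s)) + a' j * RtoC (INR s ^ j * ln (INR s)))%C)
    by (intros; ring).
  rewrite (csum_ext (fun i => (b (Z.of_nat i - Z.of_nat N)%Z + b' (Z.of_nat i - Z.of_nat N)%Z)
      * RtoC (powerRZ (INR s) (Z.of_nat i - Z.of_nat N)))%C
    (fun i => b (Z.of_nat i - Z.of_nat N)%Z * RtoC (powerRZ (INR s) (Z.of_nat i - Z.of_nat N))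
      + b' (Z.of_nat i - Z.of_nat N)%Z * RtoC (powerRZ (INR s) (Z.of_nat i - Z.of_nat N)))%C)
    by (intros; ring).
  rewrite !csum_plus; ring.
Qed.

Lemma has_expansion_real (c : C) (u : nat -> R) (J : nat) (a : nat -> R) (b : Z -> R) :
  has_real_expansion u J a b ->
  has_expansion (fun s => c * RtoC (u s))%C J (fun j => c * RtoC (a j))%C (fun z => c * RtoC (b z))%C.
Proof.
  intros H N; specialize (H N); apply is_lim_seq_abs_0 in H.
  generalize (is_lim_seq_scal_l _ (Cmod c) 0 H); simpl (Rbar_mult _ _); rewrite Rmult_0_r.
  apply is_lim_seq_ext; intros s.
  assert (Hp : 0 <= INR s ^ N) by apply pow_le, pos_INR.
  rewrite Rabs_mult, (Rabs_pos_eq (INR s ^ N)), <- Rmult_assoc by auto; f_equal.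
  rewrite <- Cmod_R, <- Cmod_mult; f_equal.
  rewrite !sum_n_csum, !RtoC_minus, !RtoC_rsum.
  rewrite (csum_ext (fun j => c * RtoC (a j) * RtoC (INR s ^ j * ln (INR s)))%C
    (fun j => c * RtoC (a j * (INR s ^ j * ln (INR s))))%C)
    by (intros; rewrite !RtoC_mult; ring).
  rewrite (csum_ext (fun i => c * RtoC (b (Z.of_nat i - Z.of_nat N)%Z)
      * RtoC (powerRZ (INR s) (Z.of_nat i - Z.of_nat N)))%C
    (fun i => c * RtoC (b (Z.of_nat i - Z.of_nat N)%Z * powerRZ (INR s) (Z.of_nat i - Z.of_nat N)))%C)
    by (intros; rewrite !RtoC_mult; ring).
  rewrite !csum_scal; ring.
Qed.

Lemma has_expansion_0 (J : nat) :
  has_expansion (fun _ => RtoC 0) J (fun _ => RtoC 0) (fun _ => RtoC 0).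
Proof.
  intros N; apply is_lim_seq_ext with (fun _ => 0); [|apply is_lim_seq_const].
  intros s; rewrite !sum_n_csum, !csum_eq0 by (intros; ring).
  replace (0 - 0 - 0)%C with (RtoC 0) by ring; rewrite Cmod_0; ring.
Qed.

(** All classes share the same [J], so their coefficients add index by index. *)
Lemma has_expansion_csum (chi : nat -> C) (u : nat -> nat -> R) (J : nat)
  (a : nat -> nat -> R) (b : nat -> Z -> R) (n : nat) :
  (forall i, (i < n)%nat -> has_real_expansion (u i) J (a i) (b i)) ->
  has_expansion (fun s => csum (fun i => chi i * RtoC (u i s))%C n) J
    (fun j => csum (fun i => chi i * RtoC (a i j))%C n)
    (fun z => csum (fun i => chi i * RtoC (b i z))%C n).
Proof.
  induction n as [|n IH]; intros H; simpl.
  - apply has_expansion_0.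
  - apply has_expansion_plus; [auto | apply has_expansion_real, H; lia].
Qed.

Lemma periodic_mul (chi : Z -> C) (m s : nat) (k : Z) :
  (forall k : Z, chi (k + Z.of_nat m)%Z = chi k) -> chi (k + Z.of_nat (m * s))%Z = chi k.
Proof.
  intros H; induction s as [|s IH].
  - rewrite Nat.mul_0_r; f_equal; simpl; lia.
  - rewrite <- IH, <- (H (k + Z.of_nat (m * s))%Z); f_equal; lia.
Qed.

Lemma twisted_log_sum_csum (chi : Z -> C) (n N : nat) :
  twisted_log_sum chi n N
  = csum (fun k => chi (Z.of_nat (S k)) * RtoC (INR (S k) ^ n * ln (INR (S k))))%C N.
Proof.
  unfold twisted_log_sum; induction N as [|N IH].
  - rewrite sum_n_m_zero by lia; reflexivity.
  - rewrite sum_n_Sm, IH by lia; reflexivity.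
Qed.

(** Class [i + 1] meets the partial block [m * s + 1, ..., m * s + l] exactly when [i < l]. *)
Definition in_last_block (l i : nat) : nat := if le_lt_dec l i then 0%nat else 1%nat.

(** Indices are written [k = m * j + (i + 1)] with [i < m]: the representatives [1, ..., m] keep
    every argument of the logarithm at least 1. *)
Lemma twisted_log_sum_residues (chi : Z -> C) (m n l s : nat) : (l < m)%nat ->
  (forall k : Z, chi (k + Z.of_nat m)%Z = chi k) ->
  twisted_log_sum chi n (m * s + l)
  = csum (fun i => chi (Z.of_nat (S i)) * RtoC (residue_log_sum n m (S i) (in_last_block l i) s))%C m.
Proof.
  intros Hl Hper; rewrite twisted_log_sum_csum, csum_add.
  set (G := fun i j => (INR (S i) + INR m * INR j) ^ n * ln (INR (S i) + INR m * INR j)).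
  assert (HG : forall i j, (chi (Z.of_nat (S (m * j + i)))
      * RtoC (INR (S (m * j + i)) ^ n * ln (INR (S (m * j + i)))) = chi (Z.of_nat (S i)) * RtoC (G i j))%C).
  { intros i j; unfold G.
    replace (Z.of_nat (S (m * j + i))) with (Z.of_nat (S i) + Z.of_nat (m * j))%Z by lia.
    rewrite periodic_mul by auto.
    replace (S (m * j + i)) with (S i + m * j)%nat by lia.
    now rewrite plus_INR, mult_INR. }
  rewrite (csum_ext (fun i => chi (Z.of_nat (S (m * s + i)))
      * RtoC (INR (S (m * s + i)) ^ n * ln (INR (S (m * s + i)))))%C
    (fun i => chi (Z.of_nat (S i)) * RtoC (G i s))%C) by (intros; apply HG).
  assert (H1 : csum (fun k => chi (Z.of_nat (S k)) * RtoC (INR (S k) ^ n * ln (INR (S k))))%C (m * s)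
     = csum (fun i => chi (Z.of_nat (S i)) * RtoC (rsum (G i) s))%C m).
  { clear Hl; induction s as [|s IH].
    - rewrite Nat.mul_0_r; simpl; rewrite csum_eq0; auto; intros; ring.
    - replace (m * S s)%nat with (m * s + m)%nat by lia.
      rewrite csum_add, IH, <- csum_plus; apply csum_ext; intros i _.
      rewrite HG; simpl rsum; rewrite RtoC_plus; ring. }
  rewrite H1.
  (* The partial block of [l] terms is extended by zeros to all [m] classes, to be added to the full
     blocks. *)
  rewrite <- (csum_ext (fun i => if le_lt_dec l i then RtoC 0
      else chi (Z.of_nat (S i)) * RtoC (G i s))%C _ l).
  2:{ intros i Hi; destruct (le_lt_dec l i); [lia | auto]. }
  rewrite <- (csum_pad _ l m), <- csum_plus; [|lia|].
  2:{ intros i Hi; destruct (le_lt_dec l i); [auto | lia]. }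
  apply csum_ext; intros i _; unfold residue_log_sum, in_last_block.
  fold (G i); destruct (le_lt_dec l i).
  - rewrite Nat.add_0_r; ring.
  - rewrite Nat.add_1_r; simpl rsum; rewrite RtoC_plus; ring.
Qed.

Lemma is_RInt_mult_r (f : R -> R) (a b y k : R) :
  is_RInt f a b y -> is_RInt (fun t => f t * k) a b (y * k).
Proof.
  intros H; rewrite (Rmult_comm y k).
  apply is_RInt_ext with (fun t => scal k (f t)).
  - intros t _; apply Rmult_comm.
  - now apply (is_RInt_scal (V := R_NormedModule)).
Qed.

(** The limit is transported along [x -> x * c], and integrals over compact intervals are taken
    coordinatewise. *)
Lemma half_line_RInt_C (f : R -> R) (l : R) (c : C) :
  is_half_line_RInt f l ->
  is_half_line_RInt (V := C_R_NormedModule) (fun t => c * RtoC (f t))%C (c * RtoC l)%C.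
Proof.
  intros Hf P HP.
  assert (Hc : forall x : R, (c * RtoC x)%C = scal (V := C_R_NormedModule) x c).
  { intros x; apply injective_projections; unfold scal; simpl;
      unfold scal, mult; simpl; unfold mult; simpl; ring. }
  rewrite Hc in HP.
  destruct (Hf _ (filterlim_scal_l (V := C_R_NormedModule) l c P HP)) as [Q1 Q2 H1 H2 HQ].
  apply Filter_prod with (1 := H1) (2 := H2); intros a b Ha Hb.
  destruct (HQ a b Ha Hb) as [y [Hy1 Hy2]]; simpl in Hy1 |- *.
  exists (scal (V := C_R_NormedModule) y c); split; auto.
  apply (is_RInt_ext (V := C_R_NormedModule) (fun t => (f t * fst c, f t * snd c))).
  { intros t _; apply injective_projections; simpl; ring. }
  apply (is_RInt_fct_extend_pair (U := R_NormedModule) (V := R_NormedModule)).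
  - exact (is_RInt_mult_r f a b y (fst c) Hy1).
  - exact (is_RInt_mult_r f a b y (snd c) Hy1).
Qed.

Lemma half_line_RInt_csum (chi : nat -> C) (f : nat -> R -> R) (l : nat -> R) (n : nat) :
  (forall i, (i < n)%nat -> is_half_line_RInt (f i) (l i)) ->
  is_half_line_RInt (V := C_R_NormedModule)
    (fun t => csum (fun i => chi i * RtoC (f i t))%C n) (csum (fun i => chi i * RtoC (l i))%C n).
Proof.
  induction n as [|n IH]; intros H; simpl.
  - generalize (half_line_RInt_C (fun _ => 0) 0 (RtoC 0) half_line_RInt_const0).
    now rewrite Cmult_0_l.
  - apply (is_RInt_gen_plus (V := C_R_NormedModule)
      (fun t => csum (fun i => chi i * RtoC (f i t))%C n) (fun t => chi n * RtoC (f n t))%C).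
    + apply IH; auto.
    + apply half_line_RInt_C, H; lia.
Qed.

(** * Membership in the field generated by [t] and [exp (- t)] *)

Lemma subfield_0 (K : C -> Prop) : is_subfield K -> K (RtoC 0).
Proof.
  intros [H1 [Hm _]]; replace (RtoC 0) with (1 - 1)%C by ring; auto.
Qed.

Lemma subfield_plus (K : C -> Prop) (x y : C) : is_subfield K -> K x -> K y -> K (x + y)%C.
Proof.
  intros HK Hx Hy; generalize (subfield_0 K HK); destruct HK as [H1 [Hm _]]; intros H0.
  replace (x + y)%C with (x - (0 - y))%C by ring; auto.
Qed.

Lemma subfield_mult (K : C -> Prop) (x y : C) : is_subfield K -> K x -> K y -> K (x * y)%C.
Proof. intros [_ [_ [H _]]]; auto. Qed.

(** Unlike in [rat_t_exp], the coefficients vanish beyond [d], so [d] can be raised and two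
    polynomials can share one bound. *)
Definition t_exp_poly (K : C -> Prop) (f : C -> C) : Prop :=
  exists (d : nat) (p : nat -> nat -> C),
    (forall i j, K (p i j)) /\
    (forall i j, (d < i \/ d < j)%nat -> p i j = RtoC 0) /\
    forall t, f t = poly2 d p t (Cexp (- t)%C).

Lemma poly2_csum (d : nat) (p : nat -> nat -> C) (x y : C) :
  poly2 d p x y = csum (fun i => csum (fun j => p i j * x ^ i * y ^ j)%C (S d)) (S d).
Proof.
  unfold poly2; rewrite sum_n_csum; apply csum_ext; intros; now rewrite sum_n_csum.
Qed.

Lemma poly2_pad (d D : nat) (p : nat -> nat -> C) (x y : C) : (d <= D)%nat ->
  (forall i j, (d < i \/ d < j)%nat -> p i j = RtoC 0) -> poly2 D p x y = poly2 d p x y.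
Proof.
  intros H Hp; rewrite !poly2_csum, (csum_pad _ (S d) (S D)); [| lia |].
  - apply csum_ext; intros i _; apply csum_pad; [lia|].
    intros j Hj; rewrite Hp by lia; ring.
  - intros i Hi; apply csum_eq0; intros j _; rewrite Hp by lia; ring.
Qed.

Lemma t_exp_poly_const (K : C -> Prop) (c : C) :
  is_subfield K -> K c -> t_exp_poly K (fun _ => c).
Proof.
  intros HK Hc; exists 0%nat, (fun i j => match i, j with O, O => c | _, _ => RtoC 0 end).
  split; [|split].
  - intros [|i] [|j]; auto; now apply subfield_0.
  - intros [|i] [|j]; auto; lia.
  - intros t; rewrite poly2_csum; simpl; ring.
Qed.

Lemma t_exp_poly_plus (K : C -> Prop) (f g : C -> C) : is_subfield K ->
  t_exp_poly K f -> t_exp_poly K g -> t_exp_poly K (fun t => f t + g t)%C.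
Proof.
  intros HK [d [p [H1 [H2 H3]]]] [d' [p' [H1' [H2' H3']]]].
  exists (max d d'), (fun i j => p i j + p' i j)%C; split; [|split].
  - intros; now apply subfield_plus.
  - intros i j Hij; rewrite H2, H2' by lia; ring.
  - intros t; rewrite H3, H3', <- (poly2_pad d (max d d') p), <- (poly2_pad d' (max d d') p')
      by (auto; lia).
    rewrite !poly2_csum, <- csum_plus; apply csum_ext; intros i _.
    rewrite <- csum_plus; apply csum_ext; intros; ring.
Qed.

Lemma t_exp_poly_scal (K : C -> Prop) (c : C) (f : C -> C) : is_subfield K -> K c ->
  t_exp_poly K f -> t_exp_poly K (fun t => c * f t)%C.
Proof.
  intros HK Hc [d [p [H1 [H2 H3]]]]; exists d, (fun i j => c * p i j)%C; split; [|split].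
  - intros; now apply subfield_mult.
  - intros i j Hij; rewrite H2 by lia; ring.
  - intros t; rewrite H3, !poly2_csum, <- csum_scal; apply csum_ext; intros i _.
    rewrite <- csum_scal; apply csum_ext; intros; ring.
Qed.

Lemma t_exp_poly_mul_t (K : C -> Prop) (f : C -> C) : is_subfield K ->
  t_exp_poly K f -> t_exp_poly K (fun t => t * f t)%C.
Proof.
  intros HK [d [p [H1 [H2 H3]]]].
  exists (S d), (fun i j => match i with O => RtoC 0 | S i => p i j end); split; [|split].
  - intros [|i] j; auto; now apply subfield_0.
  - intros [|i] j Hij; auto; apply H2; lia.
  - intros t; rewrite H3, !poly2_csum, (csum_S_l _ (S d)); cbv beta iota.
    rewrite (csum_eq0 (fun j => RtoC 0 * t ^ 0 * Cexp (- t) ^ j)%C) by (intros; ring).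
    rewrite <- csum_scal, Cplus_0_l; apply csum_ext; intros i _.
    rewrite (csum_pad _ (S d) (S (S d))); [|lia|].
    + rewrite <- csum_scal; apply csum_ext; intros; simpl; ring.
    + intros j Hj; rewrite H2 by lia; ring.
Qed.

Lemma t_exp_poly_mul_exp (K : C -> Prop) (f : C -> C) : is_subfield K ->
  t_exp_poly K f -> t_exp_poly K (fun t => Cexp (- t) * f t)%C.
Proof.
  intros HK [d [p [H1 [H2 H3]]]].
  exists (S d), (fun i j => match j with O => RtoC 0 | S j => p i j end); split; [|split].
  - intros i [|j]; auto; now apply subfield_0.
  - intros i [|j] Hij; auto; apply H2; lia.
  - intros t; rewrite H3, !poly2_csum.
    rewrite (csum_pad _ (S d) (S (S d))); [|lia|].
    + rewrite <- csum_scal; apply csum_ext; intros i _.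
      rewrite (csum_S_l _ (S d)); cbv beta iota; rewrite <- csum_scal.
      rewrite (csum_ext (fun j => Cexp (- t) * (p i j * t ^ i * Cexp (- t) ^ j))%C
        (fun j => p i j * t ^ i * Cexp (- t) ^ S j)%C) by (intros; simpl; ring).
      ring.
    + intros i Hi; apply csum_eq0; intros [|j] _; [ring | rewrite H2 by lia; ring].
Qed.

Lemma t_exp_poly_ext (K : C -> Prop) (f g : C -> C) :
  (forall t, f t = g t) -> t_exp_poly K f -> t_exp_poly K g.
Proof.
  intros H [d [p [H1 [H2 H3]]]]; exists d, p; repeat split; auto; intros; now rewrite <- H.
Qed.

Lemma t_exp_poly_csum (K : C -> Prop) (f : nat -> C -> C) (n : nat) : is_subfield K ->
  (forall i, (i < n)%nat -> t_exp_poly K (f i)) ->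
  t_exp_poly K (fun t => csum (fun i => f i t) n).
Proof.
  intros HK; induction n as [|n IH]; intros H; simpl.
  - apply t_exp_poly_const; auto; now apply subfield_0.
  - apply t_exp_poly_plus; auto.
Qed.

(** Expanding [f] into monomials reduces the product to multiplications by [t], by [exp (- t)] and
    by constants, without convolving coefficients. *)
Lemma t_exp_poly_mult (K : C -> Prop) (f g : C -> C) : is_subfield K ->
  t_exp_poly K f -> t_exp_poly K g -> t_exp_poly K (fun t => f t * g t)%C.
Proof.
  intros HK [d [p [H1 [H2 H3]]]] Hg.
  apply t_exp_poly_ext with (fun t => csum (fun i => csum (fun j =>
    p i j * (t ^ i * (Cexp (- t) ^ j * g t)))%C (S d)) (S d)).
  - intros t; rewrite H3, poly2_csum, Cmult_comm, <- csum_scal; apply csum_ext; intros i _.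
    rewrite <- csum_scal; apply csum_ext; intros; ring.
  - apply (t_exp_poly_csum K (fun i t => csum (fun j =>
      p i j * (t ^ i * (Cexp (- t) ^ j * g t)))%C (S d))); auto; intros i _.
    apply (t_exp_poly_csum K (fun j t => p i j * (t ^ i * (Cexp (- t) ^ j * g t)))%C); auto; intros j _.
    apply t_exp_poly_scal; auto.
    induction i as [|i IHi].
    + induction j as [|j IHj].
      * apply t_exp_poly_ext with g; auto; intros; simpl; ring.
      * apply t_exp_poly_ext with (2 := t_exp_poly_mul_exp _ _ HK IHj); intros; simpl; ring.
    + apply t_exp_poly_ext with (2 := t_exp_poly_mul_t _ _ HK IHi); intros; simpl; ring.
Qed.

Lemma rat_t_exp_div (K : C -> Prop) (f g : C -> C) :
  t_exp_poly K f -> t_exp_poly K g -> (exists t, g t <> RtoC 0) ->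
  rat_t_exp K (fun t => f t / g t)%C.
Proof.
  intros [d [p [H1 [H2 H3]]]] [d' [q [H1' [H2' H3']]]] [t0 Ht0].
  exists (max d d'), p, q; repeat split; auto.
  - exists t0; rewrite (poly2_pad d' (max d d') q) by (auto; lia); now rewrite <- H3'.
  - intros t _; rewrite (poly2_pad d (max d d') p), (poly2_pad d' (max d d') q) by (auto; lia).
    now rewrite <- H3, <- H3'.
Qed.

(** Lying in every subfield of C characterises Q and gives membership in Q(chi) at once. *)
Definition is_rational (x : R) : Prop := forall K, is_subfield K -> K (RtoC x).

Lemma is_rational_1 : is_rational 1.
Proof. intros K [H _]; exact H. Qed.

Lemma is_rational_minus (x y : R) : is_rational x -> is_rational y -> is_rational (x - y).
Proof. intros Hx Hy K HK; rewrite RtoC_minus; apply (proj1 (proj2 HK)); [apply Hx | apply Hy]; exact HK. Qed.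

Lemma is_rational_mult (x y : R) : is_rational x -> is_rational y -> is_rational (x * y).
Proof. intros Hx Hy K HK; rewrite RtoC_mult; apply subfield_mult; [exact HK | now apply Hx | now apply Hy]. Qed.

Lemma is_rational_0 : is_rational 0.
Proof. intros K HK; now apply subfield_0. Qed.

Lemma is_rational_opp (x : R) : is_rational x -> is_rational (- x).
Proof.
  intros H; replace (- x) with (0 - x) by ring; apply is_rational_minus; auto.
  apply is_rational_0.
Qed.

Lemma is_rational_plus (x y : R) : is_rational x -> is_rational y -> is_rational (x + y).
Proof.
  intros Hx Hy; replace (x + y) with (x - - y) by ring.
  apply is_rational_minus; auto; now apply is_rational_opp.
Qed.

Lemma is_rational_inv (x : R) : is_rational x -> is_rational (/ x).
Proof.
  intros Hx; destruct (Req_dec x 0) as [->|H].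
  (* Default value: [/ 0] is 0 in [R]. *)
  - rewrite Rinv_0; apply is_rational_0.
  - intros K HK; rewrite RtoC_inv by exact H; destruct (HK) as [_ [_ [_ Hi]]].
    apply Hi; [now apply Hx|]; intros E; apply H; now apply RtoC_inj.
Qed.

Lemma is_rational_pow (x : R) (n : nat) : is_rational x -> is_rational (x ^ n).
Proof.
  intros H; induction n; simpl; [apply is_rational_1 | now apply is_rational_mult].
Qed.

Lemma is_rational_INR (n : nat) : is_rational (INR n).
Proof.
  induction n; [apply is_rational_0|]; rewrite S_INR; apply is_rational_plus; auto.
  apply is_rational_1.
Qed.

Lemma is_rational_exp_tc (n : nat) : is_rational (exp_tc n).
Proof.
  apply is_rational_mult; [apply is_rational_pow | apply is_rational_inv, is_rational_INR].
  replace (-1) with (- (1)) by ring; apply is_rational_opp, is_rational_1.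
Qed.

Lemma is_rational_exp_coef (y : R) (i : nat) : is_rational y -> is_rational (exp_coef y i).
Proof.
  intros H; apply is_rational_mult; [|apply is_rational_inv, is_rational_INR].
  now apply is_rational_pow, is_rational_opp.
Qed.

(** Long division of power series uses only field operations on the coefficients. *)
Lemma is_rational_geom_coef (m p : R) (k : nat) :
  is_rational m -> is_rational p -> is_rational (geom_coef m p k).
Proof.
  intros Hm Hp.
  assert (Hd : forall i, is_rational (den_coef m i)).
  { intros i; apply is_rational_opp; now apply is_rational_exp_coef. }
  assert (Hr : forall i, is_rational (series_rem (exp_coef p) (den_coef m) k i)).
  { induction k as [|k IH]; intros i; [now apply is_rational_exp_coef|].
    apply (is_rational_minus (series_rem (exp_coef p) (den_coef m) k (S i))); auto.
    apply is_rational_mult; auto; apply is_rational_mult; auto; now apply is_rational_inv. }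
  apply is_rational_mult; auto; now apply is_rational_inv.
Qed.

(* Functions of a real variable that extend to polynomials in [t] and
   [exp (- t)] with coefficients in every subfield of [C], in [Q] that is. *)
Definition real_t_exp_poly (f : R -> R) : Prop :=
  forall K, is_subfield K -> exists P, t_exp_poly K P /\ forall t : R, P (RtoC t) = RtoC (f t).

Lemma real_t_exp_poly_ext (f g : R -> R) :
  (forall t, f t = g t) -> real_t_exp_poly f -> real_t_exp_poly g.
Proof.
  intros H Hf K HK; destruct (Hf K HK) as [P [HP E]]; exists P; split; auto.
  intros; now rewrite E, H.
Qed.

Lemma real_t_exp_poly_const (c : R) : is_rational c -> real_t_exp_poly (fun _ => c).
Proof.
  intros Hc K HK; exists (fun _ => RtoC c); split; auto.
  apply t_exp_poly_const; [exact HK | now apply Hc].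
Qed.

Lemma real_t_exp_poly_plus (f g : R -> R) :
  real_t_exp_poly f -> real_t_exp_poly g -> real_t_exp_poly (fun t => f t + g t).
Proof.
  intros Hf Hg K HK; destruct (Hf K HK) as [P [HP EP]]; destruct (Hg K HK) as [Q [HQ EQ]].
  exists (fun t => P t + Q t)%C; split; [now apply t_exp_poly_plus|].
  intros; now rewrite EP, EQ, RtoC_plus.
Qed.

Lemma real_t_exp_poly_mult (f g : R -> R) :
  real_t_exp_poly f -> real_t_exp_poly g -> real_t_exp_poly (fun t => f t * g t).
Proof.
  intros Hf Hg K HK; destruct (Hf K HK) as [P [HP EP]]; destruct (Hg K HK) as [Q [HQ EQ]].
  exists (fun t => P t * Q t)%C; split; [now apply t_exp_poly_mult|].
  intros; now rewrite EP, EQ, RtoC_mult.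
Qed.

Lemma real_t_exp_poly_minus (f g : R -> R) :
  real_t_exp_poly f -> real_t_exp_poly g -> real_t_exp_poly (fun t => f t - g t).
Proof.
  intros Hf Hg; apply real_t_exp_poly_ext with (fun t => f t + (-1) * g t); [intros; ring|].
  apply real_t_exp_poly_plus, real_t_exp_poly_mult; auto.
  apply real_t_exp_poly_const; replace (-1) with (- (1)) by ring.
  apply is_rational_opp, is_rational_1.
Qed.

Lemma real_t_exp_poly_id : real_t_exp_poly (fun t => t).
Proof.
  intros K HK; exists (fun t => t * 1)%C; split; [|intros; ring].
  apply t_exp_poly_mul_t, t_exp_poly_const; auto; now apply is_rational_1.
Qed.

Lemma Cexp_RtoC (t : R) : Cexp (- RtoC t)%C = RtoC (exp (- t)).
Proof.
  unfold Cexp; simpl; rewrite Ropp_0, cos_0, sin_0; apply injective_projections; simpl; ring.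
Qed.

Lemma real_t_exp_poly_exp : real_t_exp_poly (fun t => exp (- t)).
Proof.
  intros K HK; exists (fun t => Cexp (- t) * 1)%C; split; [|intros; rewrite Cexp_RtoC; ring].
  apply t_exp_poly_mul_exp, t_exp_poly_const; auto; now apply is_rational_1.
Qed.

Lemma real_t_exp_poly_pow (f : R -> R) (n : nat) :
  real_t_exp_poly f -> real_t_exp_poly (fun t => f t ^ n).
Proof.
  intros Hf; induction n as [|n IH]; simpl.
  - apply real_t_exp_poly_const, is_rational_1.
  - now apply real_t_exp_poly_mult.
Qed.

(** Integrality of [m] and [r] matters here: [exp (- (n * t))] is then a power of [exp (- t)]. *)
Lemma real_t_exp_poly_exp_nat (n : nat) : real_t_exp_poly (fun t => exp (- (INR n * t))).
Proof.
  apply real_t_exp_poly_ext with (fun t => exp (- t) ^ n).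
  - intros t; induction n as [|n IH].
    + simpl; rewrite Rmult_0_l, Ropp_0, exp_0; auto.
    + rewrite S_INR; replace (- ((INR n + 1) * t)) with (- t + - (INR n * t)) by ring.
      rewrite exp_plus, <- IH; reflexivity.
  - apply real_t_exp_poly_pow, real_t_exp_poly_exp.
Qed.

Lemma real_t_exp_poly_sum (c : nat -> R) (n : nat) : (forall k, is_rational (c k)) ->
  real_t_exp_poly (fun t => rsum (fun k => c k * t ^ k) n).
Proof.
  intros Hc; induction n as [|n IH]; simpl.
  - apply real_t_exp_poly_const, is_rational_0.
  - apply real_t_exp_poly_plus, real_t_exp_poly_mult; auto.
    + now apply real_t_exp_poly_const.
    + apply (real_t_exp_poly_pow (fun t => t)), real_t_exp_poly_id.
Qed.

(** It depends on [n] and [m] alone: one denominator serves all residue classes, and adding them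
    only adds numerators. *)
Definition common_den (n m : nat) (t : R) : R := t ^ S (S n) * (1 - exp (- (INR m * t))).

Definition has_common_den (n m : nat) (f : R -> R) : Prop :=
  exists g, real_t_exp_poly g /\ forall t, 0 < t -> f t * common_den n m t = g t.

Ltac rational := solve
  [ repeat first [ assumption | apply is_rational_1 | apply is_rational_INR
                 | apply is_rational_exp_tc | apply is_rational_geom_coef ] ].

Ltac t_exp_poly :=
  repeat first
    [ assumption
    | apply real_t_exp_poly_const; rational
    | apply real_t_exp_poly_id | apply real_t_exp_poly_exp | apply real_t_exp_poly_exp_nat
    | apply real_t_exp_poly_sum; intros; rational
    | apply (real_t_exp_poly_pow (fun t => t))
    | apply real_t_exp_poly_minus | apply real_t_exp_poly_plus | apply real_t_exp_poly_mult ].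

Lemma common_den_poly (n m : nat) : real_t_exp_poly (common_den n m).
Proof. unfold common_den; t_exp_poly. Qed.

Lemma common_den_pos (n m : nat) (t : R) : (1 <= m)%nat -> 0 < t -> 0 < common_den n m t.
Proof.
  intros Hm Ht; assert (0 < INR m) by (apply (lt_INR 0); lia).
  apply Rmult_lt_0_compat; [now apply pow_lt|].
  assert (exp (- (INR m * t)) < exp 0) by (apply exp_increasing; nra).
  rewrite exp_0 in H0; lra.
Qed.

Lemma has_common_den_plus (n m : nat) (f g : R -> R) :
  has_common_den n m f -> has_common_den n m g -> has_common_den n m (fun t => f t + g t).
Proof.
  intros [f' [Hf Ef]] [g' [Hg Eg]]; exists (fun t => f' t + g' t); split; [t_exp_poly|].
  intros t Ht; rewrite <- Ef, <- Eg by auto; ring.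
Qed.

Lemma has_common_den_scal (n m : nat) (c : R) (f : R -> R) :
  is_rational c -> has_common_den n m f -> has_common_den n m (fun t => c * f t).
Proof.
  intros Hc [f' [Hf Ef]]; exists (fun t => c * f' t); split; [t_exp_poly|].
  intros t Ht; rewrite <- Ef by auto; ring.
Qed.

Lemma has_common_den_minus (n m : nat) (f g : R -> R) :
  has_common_den n m f -> has_common_den n m g -> has_common_den n m (fun t => f t - g t).
Proof.
  intros [f' [Hf Ef]] [g' [Hg Eg]]; exists (fun t => f' t - g' t); split; [t_exp_poly|].
  intros t Ht; rewrite <- Ef, <- Eg by auto; ring.
Qed.

(** Each piece is a Taylor remainder over a power of [t]. Multiplied back, it is the original
    exponential expression minus a rational polynomial and the counterterm. *)
Lemma residue_integrand_common_den (n m r e : nat) : (1 <= m)%nat -> (1 <= r)%nat ->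
  has_common_den n m (residue_integrand n m r e).
Proof.
  intros Hm Hr; unfold residue_integrand.
  assert (HM : 1 <= INR m) by (apply (le_INR 1); auto).
  assert (HR : 1 <= INR r) by (apply (le_INR 1); auto).
  assert (Hg : forall k, is_rational (geom_coef (INR m) (INR r) k)).
  { intros; apply is_rational_geom_coef; apply is_rational_INR. }
  assert (Hg' : forall k, is_rational (geom_coef (INR m) (INR (r + m * e)) k)).
  { intros; apply is_rational_geom_coef; apply is_rational_INR. }
  assert (HF : is_rational (/ exp_tc n)) by (apply is_rational_inv, is_rational_exp_tc).
  apply has_common_den_scal; auto; apply has_common_den_minus; [apply has_common_den_plus|].
  - apply has_common_den_scal; auto.
    exists (fun t => (exp (- (INR m * t)) - exp (- t)) * (t ^ S n * (1 - exp (- (INR m * t))))).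
    split; [t_exp_poly|].
    intros t Ht; unfold common_den.
    generalize (log_kernel_eq 0 (INR m) t ltac:(lra) Ht); unfold exp_tc; simpl; intros E.
    replace (exp (- (INR m * t)) - exp (- t)) with (t * 1 * log_kernel 0 (INR m) t)
      by (rewrite E; field).
    ring.
  - apply has_common_den_scal.
    { apply is_rational_mult; auto; now apply is_rational_minus. }
    exists (fun t => (exp (- t) - rsum (fun i => exp_tc i * t ^ i) n - exp_tc n * t ^ n * exp (- t))
      * (t * (1 - exp (- (INR m * t))))).
    split; [t_exp_poly|].
    intros t Ht; unfold common_den.
    (* At [y = 1] the Frullani part vanishes and [log_kernel n 1] is the regularised exponential. *)
    generalize (log_kernel_eq n 1 t Rlt_0_1 Ht); rewrite Rmult_1_l; intros <-.
    unfold log_kernel; rewrite Rmult_1_l, !pow1; simpl; field; lra.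
  - exists (fun t => t * exp (- (INR r * t))
      - (rsum (fun k => geom_coef (INR m) (INR r) k * t ^ k) (S n)
         + t ^ S n * geom_coef (INR m) (INR r) (S n) * exp (- t)) * (1 - exp (- (INR m * t)))).
    split.
    { t_exp_poly. }
    intros t Ht; unfold common_den.
    assert (HT : taylor (geom_rem (INR m) (INR r)) (geom_coef (INR m) (INR r)))
      by (apply taylor_geom; lra).
    assert (Hlt : exp (- (INR m * t)) < 1) by (rewrite <- exp_0; apply exp_increasing; nra).
    replace (t * exp (- (INR r * t))) with (geom_rem (INR m) (INR r) 0 t * (1 - exp (- (INR m * t)))).
    + rewrite (taylor_sum _ _ (S n) t HT Ht); unfold regularized; simpl; field; lra.
    + rewrite geom_rem_0 by lra; field; lra.
Qed.

Lemma is_subfield_value_field (chi : Z -> C) : is_subfield (value_field chi).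
Proof.
  split; [|split; [|split]].
  - intros K [H _] _; exact H.
  - intros x y Hx Hy K HK Hc; apply (proj1 (proj2 HK)); [now apply Hx | now apply Hy].
  - intros x y Hx Hy K HK Hc; apply subfield_mult; [exact HK | now apply Hx | now apply Hy].
  - intros x Hx H0 K HK Hc; apply (proj2 (proj2 (proj2 HK))); [now apply Hx | exact H0].
Qed.

Lemma csum_common_den_rat_t_exp (K : C -> Prop) (chi : nat -> C) (n0 m0 n : nat) (f : nat -> R -> R) :
  is_subfield K -> (1 <= m0)%nat -> (forall i, K (chi i)) ->
  (forall i, (i < n)%nat -> has_common_den n0 m0 (f i)) ->
  exists g, rat_t_exp K g /\
    forall t, 0 < t -> csum (fun i => chi i * RtoC (f i t))%C n = g (RtoC t).
Proof.
  intros HK Hm Hchi H.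
  destruct (common_den_poly n0 m0 K HK) as [D [HD ED]].
  assert (HD0 : forall t : R, 0 < t -> D (RtoC t) <> RtoC 0).
  { intros t Ht E; rewrite ED in E; apply RtoC_inj in E.
    generalize (common_den_pos n0 m0 t Hm Ht); lra. }
  assert (HP : exists P, t_exp_poly K P /\ forall t, 0 < t ->
    (csum (fun i => chi i * RtoC (f i t)) n * D (RtoC t) = P (RtoC t))%C).
  { induction n as [|n IH]; simpl.
    - exists (fun _ => RtoC 0); split; [|intros; ring].
      apply t_exp_poly_const; auto; now apply subfield_0.
    - destruct IH as [P [HP EP]]; [auto|].
      destruct (H n) as [g [Hg Eg]]; [lia|].
      destruct (Hg K HK) as [Q [HQ EQ]].
      exists (fun t => P t + chi n * Q t)%C; split.
      + apply t_exp_poly_plus; auto; now apply t_exp_poly_scal.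
      + intros t Ht; rewrite <- EP, EQ, <- Eg, RtoC_mult, <- ED by auto; ring. }
  destruct HP as [P [HP EP]].
  exists (fun t => P t / D t)%C; split.
  (* The denominator is positive on the open half line, so [t = 1] shows that it is not the zero
     function. *)
  - apply rat_t_exp_div; auto; exists (RtoC 1); apply HD0; lra.
  - intros t Ht; rewrite <- EP by auto; field; now apply HD0.
Qed.

Theorem corollary1p19 (chi : Z -> C) (m n : nat)
  (hm : (1 <= m)%nat)
  (hper : forall k : Z, chi (k + Z.of_nat m)%Z = chi k)
  (h0 : chi 0%Z = RtoC 0) :
  forall l : nat, (l < m)%nat ->
    exponential_period (rat_t_exp (value_field chi)) (twisted_stirling chi m n l).
Proof.
  intros l Hl.
  (* Choice turns the expansions of the classes into functions of [i], over which [csum] can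
     range. *)
  destruct (functional_choice (fun i ab => has_real_expansion
      (residue_log_sum n m (S i) (in_last_block l i)) (S n) (fst ab) (snd ab) /\
    is_half_line_RInt (residue_integrand n m (S i) (in_last_block l i)) (snd ab 0%Z)))
    as [ab Hab].
  { intros i; destruct (residue_log_sum_expansion n m (S i) (in_last_block l i)) as [a [b H]];
      [auto | lia |]; now exists (a, b). }
  set (c := fun i => chi (Z.of_nat (S i))).
  assert (HT : twisted_stirling chi m n l = csum (fun i => c i * RtoC (snd (ab i) 0%Z))%C m).
  { apply constant_term_eq.
    exists (S n), (fun j => csum (fun i => c i * RtoC (fst (ab i) j))%C m),
      (fun z => csum (fun i => c i * RtoC (snd (ab i) z))%C m); split; [|reflexivity].
    intros N; eapply is_lim_seq_ext.
    2: apply (has_expansion_csum c _ (S n) (fun i => fst (ab i)) (fun i => snd (ab i)) m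
                (fun i _ => proj1 (Hab i))).
    intros s; simpl; rewrite twisted_log_sum_residues; auto. }
  rewrite HT.
  destruct (csum_common_den_rat_t_exp (value_field chi) c n m m
     (fun i => residue_integrand n m (S i) (in_last_block l i))) as [f [Hf Ef]]; auto.
  - apply is_subfield_value_field.
  - intros i K HK HKc; apply HKc.
  - intros i _; apply residue_integrand_common_den; auto; lia.
  - exists f; split; auto.
    apply half_line_RInt_ext with (1 := Ef).
    apply (half_line_RInt_csum c (fun i => residue_integrand n m (S i) (in_last_block l i))).
    intros i _; apply Hab.
Qed.
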